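(* Suppose there exists a positive definite function $\bar V:\mathcal X\to\mathbb R$ (i.e. $\bar V(\mathbf x)>0$ for $\mathbf x\in\mathcal X\setminus\{\mathbf 0\}$) with the boundary conditions $$\bar V(\mathbf 0)=0,\qquad \bar V(\mathbf x)\ge 1\ \text{ for all }\mathbf x\in\partial\mathcal X,$$ whose time derivative along the closed-loop system satisfies $$\begin{cases}\dot{\bar V}(\mathbf x)+\left(1-\bar V(\mathbf x)\right)^2\le 0, & \text{if }\mathbf x\notin\mathcal X_g,\\ \dot{\bar V}(\mathbf x)<0, & \text{if }\mathbf x\in\mathcal X_g,\ \mathbf x\ne\mathbf 0.\end{cases}$$ Then: (1) the origin is asymptotically stable for the closed-loop system; (2) the strict 1-sublevel set $\Omega_{\bar V_1}=\{\mathbf x\in\mathcal X:\bar V(\mathbf x)<1\}$ is an estimate of the origin's domain of attraction, that is, every solution starting in $\Omega_{\bar V_1}$ remains in $\Omega_{\bar V_1}$ for all future times and converges to the origin; (3) every solution starting at a point $\mathbf x\in\Omega_{\bar V_1}$ reaches the set $\mathcal X_g$ in finite time, and the time taken to reach $\mathcal X_g$ is at most $\dfrac{\bar V(\mathbf x)}{1-\bar V(\mathbf x)}$.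
   Context: System. $\dot{\mathbf x}=\sum_{i=1}^r\alpha_i(A_i\mathbf x+B_i\mathbf u)$ with $\mathbf x\in\mathcal X\subset\mathbb R^n$, $\mathbf u\in\mathcal U=\{\mathbf u\in\mathbb R^m:\underline u_i\le u_i\le\bar u_i,\ i=1,\dots,m\}$, $A_i\in\mathbb R^{n\times n}$, $B_i\in\mathbb R^{n\times m}$, and uncertain weights $\boldsymbol\alpha$ in the unit simplex ($\alpha_i\ge0$, $\sum_i\alpha_i=1$). The set $\mathcal X$ is closed and bounded and contains the origin, and $\mathcal X_g\subseteq\mathcal X$ is a set containing the origin. A state-feedback law $\mathbf u(\mathbf x)\in\mathcal U$, possibly discontinuous, is fixed; substituting it gives the closed-loop system. Solutions and time derivative. Because the weights are uncertain and the feedback may be discontinuous, the closed-loop system is understood as a differential inclusion $\dot{\mathbf x}\in F(\mathbf x)$, where $F$ is upper semicontinuous on $\mathcal X$ with nonempty compact convex values and contains the closed-loop vector field for every admissible $\boldsymbol\alpha$ (Filippov regularization). Solutions are absolutely continuous curves satisfying the inclusion for almost every time. The function $\bar V$ is continuous on $\mathcal X$ and locally Lipschitz in the interior of $\mathcal X$. An inequality on $\dot{\bar V}(\mathbf x)$, at a point $\mathbf x$ of the interior of $\mathcal X$, means that it holds with $\dot{\bar V}(\mathbf x)$ replaced by $\mathbf g^T\mathbf v$ for every $\mathbf g$ in the Clarke generalized gradient of $\bar V$ at $\mathbf x$ and every $\mathbf v\in F(\mathbf x)$. If $\bar V$ is continuously differentiable and $F(\mathbf x)=\{f(\mathbf x)\}$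 is single-valued, this is the usual $\dot{\bar V}(\mathbf x)=\nabla\bar V(\mathbf x)^Tf(\mathbf x)$. *)

(* Defs.v *)
From HB Require Import structures.
From mathcomp Require Import all_boot all_order all_algebra.
From mathcomp Require Import all_classical all_reals all_analysis.
Set Implicit Arguments.
Unset Strict Implicit.
Unset Printing Implicit Defensive.
Import Order.TTheory GRing.Theory Num.Theory.
Import numFieldNormedType.Exports.
Local Open Scope classical_set_scope.
Local Open Scope ring_scope.

Definition boundary (T : topologicalType) (X : set T) : set T :=
  closure X `\` X°.

Definition simplex (R : realType) (r : nat) : set ('I_r -> R) :=
  [set a | (forall i, 0 <= a i) /\ \sum_(i < r) a i = 1].

Definition box (R : realType) (m : nat) (lo hi : 'cV[R]_m) : set 'cV[R]_m :=
  [set u | forall i, lo i 0 <= u i 0 <= hi i 0].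

Definition closed_loop (R : realType) (n m r : nat)
    (A : 'I_r -> 'M[R]_n) (B : 'I_r -> 'M[R]_(n, m))
    (u : 'cV[R]_n -> 'cV[R]_m) (a : 'I_r -> R) (x : 'cV[R]_n) : 'cV[R]_n :=
  \sum_(i < r) a i *: (A i *m x + B i *m u x).

(* Set-valued maps and functions on X are total in the code; only their values
   on X are ever constrained or used. *)
Definition upper_semicontinuous (R : realType) (n : nat) (X : set 'cV[R]_n)
    (F : 'cV[R]_n -> set 'cV[R]_n) : Prop :=
  forall x, X x -> forall O, open O -> F x `<=` O ->
    \forall y \near within X (nbhs x), F y `<=` O.

Definition locally_lipschitz (R : realType) (n : nat) (D : set 'cV[R]_n)
    (V : 'cV[R]_n -> R) : Prop :=
  forall x, D x -> exists2 U, nbhs x U & [lipschitz V y | y in U].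

(* Clarke's generalized directional derivative: the limsup of
   (V (y + s v) - V y) / s as y tends to x and s decreases to 0. *)
Definition clarke_derivative (R : realType) (n : nat) (V : 'cV[R]_n -> R)
    (x v : 'cV[R]_n) : \bar R :=
  limf_esup (fun p : 'cV[R]_n * R => ((V (p.1 + p.2 *: v) - V p.1) / p.2)%:E)
    (filter_prod (nbhs x) (0 : R)^'+).

Definition clarke_gradient (R : realType) (n : nat) (V : 'cV[R]_n -> R)
    (x : 'cV[R]_n) : set 'cV[R]_n :=
  [set g | forall v, (((g^T *m v) 0 0)%:E <= clarke_derivative V x v)%E].

(* All the values taken by the time derivative of V at x along the inclusion. *)
Definition time_derivative (R : realType) (n : nat)
    (F : 'cV[R]_n -> set 'cV[R]_n) (V : 'cV[R]_n -> R) (x : 'cV[R]_n) : set R :=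
  [set (g^T *m v) 0 0 | g in clarke_gradient V x & v in F x].

Definition absolutely_continuous (R : realType) (n : nat) (a b : R)
    (x : R -> 'cV[R]_n) : Prop :=
  forall e : R, 0 < e -> exists2 d : R, 0 < d &
    forall (N : nat) (s t : 'I_N -> R),
      (forall i, a <= s i /\ s i <= t i /\ t i <= b) ->
      (forall i j, i != j -> t i <= s j \/ t j <= s i) ->
      \sum_(i < N) (t i - s i) < d ->
      \sum_(i < N) `|x (t i) - x (s i)| < e.

(* A solution lives on [0, T) with 0 < T <= +oo; the values of x outside
   [0, T) are irrelevant. Absolute continuity on a half-open interval is
   absolute continuity on its compact subintervals. *)
Definition solution (R : realType) (n : nat) (X : set 'cV[R]_n)
    (F : 'cV[R]_n -> set 'cV[R]_n) (T : \bar R) (x : R -> 'cV[R]_n) : Prop :=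
  [/\ (0 < T)%E,
      forall t : R, 0 <= t -> (t%:E < T)%E -> X (x t),
      forall b : R, 0 <= b -> (b%:E < T)%E -> absolutely_continuous 0 b x &
      {ae @lebesgue_measure R, forall t : R, 0 < t -> (t%:E < T)%E ->
         derivable x t 1 /\ F (x t) (derive1 x t)}].

Definition maximal_solution (R : realType) (n : nat) (X : set 'cV[R]_n)
    (F : 'cV[R]_n -> set 'cV[R]_n) (T : \bar R) (x : R -> 'cV[R]_n) : Prop :=
  solution X F T x /\
  forall (T' : \bar R) (y : R -> 'cV[R]_n), solution X F T' y -> (T <= T')%E ->
    (forall t : R, 0 <= t -> (t%:E < T)%E -> y t = x t) -> T' = T.

Definition asymptotically_stable (R : realType) (n : nat) (X : set 'cV[R]_n)
    (F : 'cV[R]_n -> set 'cV[R]_n) : Prop :=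
  [/\ F 0 0,
      forall e : R, 0 < e -> exists2 d : R, 0 < d &
        forall T x, solution X F T x -> `|x 0| < d ->
          forall t : R, 0 <= t -> (t%:E < T)%E -> `|x t| < e &
      exists2 d : R, 0 < d &
        forall T x, maximal_solution X F T x -> `|x 0| < d ->
          T = +oo%E /\ x t @[t --> +oo] --> (0 : 'cV[R]_n)].

Definition strict_sublevel (R : realType) (n : nat) (X : set 'cV[R]_n)
    (V : 'cV[R]_n -> R) : set 'cV[R]_n :=
  [set x | X x /\ V x < 1].

(* Main.v *)
Require Import Defs.
From HB Require Import structures.
From mathcomp Require Import all_boot all_order all_algebra.
From mathcomp Require Import all_classical all_reals all_analysis.
From mathcomp Require Import ring lra measurable_realfun.
Set Implicit Arguments.
Unset Strict Implicit.
Unset Printing Implicit Defensive.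
Import Order.TTheory GRing.Theory Num.Theory.
Import numFieldNormedType.Exports.
Local Open Scope classical_set_scope.
Local Open Scope ring_scope.

(** The value of V along a solution decreases because, at almost every time,
    the difference quotient of V along the velocity is bounded by the Clarke
    directional derivative, which is attained by some gradient
    (Hahn-Banach). An absolutely continuous function with such a bound off a
    null set is controlled by covering the null set with a small open set. The
    rate (1 - V)^2 makes 1 / (1 - V) decrease at unit speed outside Xg, hence
    the bound on the reaching time. Compactness of the sets l <= V <= V (x 0)
    gives a uniform rate of decrease on them, hence convergence to the origin.

    Two points are not about V. A maximal solution is defined for all times
    because it is Lipschitz, so it has a limit inside X, from which Euler
    polygons (converging along an ultrafilter) continue it. The origin is an
    equilibrium although u 0 may be nonzero: otherwise g . v < 0 on F near 0 for
    some g, and a minimum of V + a exp (B g . x), which for large B is not at 0,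
    exhibits a gradient of V that increases along F. *)

(** * Almost everywhere derivability of Lipschitz functions *)

(** Along a solution only increments between two times straddling a good time are available, and
    their direction is merely close to a velocity. Clarke's derivative suits them because its limsup
    also moves the base point: the resulting notion of decrease is uniform in the base point, in the
    velocities of [F] and in nearby directions, so it passes through upper semicontinuity and
    compactness.

    Decrease is known only where [V < 1] and away from 0, so monotonicity cannot presuppose that the
    sublevel set is invariant; it comes from the last passage through an intermediate level.

    Almost everywhere derivability serves the continuation of solutions: a limit of Euler polygons
    is only Lipschitz, yet it must have a velocity in [F] at almost every time.

    The decrease condition is silent at 0, so an equilibrium there must be read off from nearby
    points. The tilt added to [V] has to be steep at 0, to beat the Lipschitz constant of [V], and
    nonnegative, so that [V] is small at the minimum, which then lies inside the ball. The
    exponential meets both demands. *)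

Lemma lebesgue_stieltjes_itv (R : realType) (g : cumulative R R) (a b : R) :
  a <= b -> lebesgue_stieltjes_measure g `]a, b]%classic = (g b - g a)%:E.
Proof.
move=> ab; rewrite /lebesgue_stieltjes_measure /measure_extension.
rewrite measurable_mu_extE/=; last by exact: is_ocitv.
by rewrite wlength_itv_bnd.
Qed.

(** The Stieltjes measures of [g] and [h] add up to Lebesgue measure, since they do so on half-open
    intervals. A Lebesgue null set is thus null for each nonnegative summand. *)
Lemma lebesgue_stieltjes_dominates (R : realType) (g h : cumulative R R) :
  (forall t, g t + h t = t) ->
  lebesgue_stieltjes_measure g `<< @lebesgue_measure R.
Proof.
move=> ght; apply/null_content_dominatesP => A mA A0.
pose nu := measure_add (lebesgue_stieltjes_measure g)
                       (lebesgue_stieltjes_measure h).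
have E : forall A, measurable A -> @lebesgue_measure R A = nu A.
  apply: lebesgue_measure_unique => X /ocitvP[->|[[a b]/= /ltW ab ->]].
    by rewrite !measure0.
  rewrite /nu/= /measure_add/= /msum/= 2!big_ord_recl big_ord0 /=.
  rewrite /lebesgue_measure !lebesgue_stieltjes_itv// adde0 -EFinD /=.
  by congr EFin; rewrite -{1}(ght a) -{1}(ght b); ring.
have := E _ mA; rewrite A0 /nu /measure_add/= /msum/=.
rewrite 2!big_ord_recl big_ord0 /= adde0 => /esym/eqP.
by rewrite padde_eq0 ?measure_ge0// => /andP[/eqP].
Qed.

(** By Radon-Nikodym [g] is, up to a constant, the integral of a density, and Lebesgue
    differentiation applies to that integral. *)
Lemma cumulative_derivable_ae (R : realType) (g h : cumulative R R) (a b : R) :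
  (forall t, g t + h t = t) ->
  {ae @lebesgue_measure R, forall t, a < t < b -> derivable (g : R -> R) t 1}.
Proof.
move=> ght; have mab : measurable (`]a, b]%classic : set (measurableTypeR R)).
  exact: measurable_itv.
have [ab|ba] := ltP a b; last first.
  by apply: aeW => t /andP[/lt_trans h1 /h1]; rewrite ltNge ba.
have fin : (lebesgue_stieltjes_measure g `]a, b]%classic < +oo)%E.
  by rewrite lebesgue_stieltjes_itv ?ltW// ltry.
(* Cutting the measure down to a bounded interval makes it finite, so that its density is
   integrable. *)
pose nu := mfrestr mab fin.
have nuE A : nu A = lebesgue_stieltjes_measure g (A `&` `]a, b]) by [].
have numu : nu `<< @lebesgue_measure R.
  apply/null_content_dominatesP => A mA A0; rewrite nuE.
  apply/eqP; rewrite eq_le measure_ge0 andbT.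
  have := lebesgue_stieltjes_dominates ght => /null_content_dominatesP/(_ _ mA A0) <-.
  by apply: le_measure; rewrite ?inE//; exact: measurableI.
have [f [f0 ffin intf fE]] := radon_nikodym_sigma_finite numu.
have finf A : measurable A -> lebesgue_measure.-integrable A (EFin \o (fine \o f)).
  move=> mA; apply: (eq_integrable mA f).
    by move=> x _ /=; rewrite fineK.
  exact: integrableS intf.
have locf : locally_integrable setT (fine \o f).
  by apply: open_integrable_locally; [exact: openT|exact: finf].
have := lebesgue_differentiation locf.
apply: (@filterS _ _ (ae_filter_ringOfSetsType _)) => t ft /andP[ta tb].
have [] := @FTC1_lebesgue_pt R (fine \o f) (BRight a) t b tb
  (finf _ (measurable_itv _)) _ ft.
  by [].
move=> dF _; suff : derivable (fun y => g y - g a) t 1.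
  move=> dg; have -> : (g : R -> R) = (fun y => g y - g a) \+ cst (g a).
    by apply/funext => y /=; rewrite subrK.
  by apply: derivableD => //; exact: derivable_cst.
apply: near_eq_derivable dF; near=> y.
have ay : a < y by near: y; exact: lt_nbhsr.
have yb : y < b by near: y; exact: lt_nbhsl.
rewrite /Rintegral /=.
under eq_integral do rewrite fineK//.
rewrite -fE; last exact: measurable_itv.
rewrite [X in fine X](nuE _) (_ : _ `&` _ = `]a, y]%classic)
  ?lebesgue_stieltjes_itv ?ltW//.
apply/setIidPl => z /=; rewrite !in_itv/= => /andP[-> /le_lt_trans].
by move=> /(_ _ yb)/ltW.
Unshelve. all: by end_near. Qed.

Lemma lipschitz_derivable_ae (R : realType) (f : R -> R) (L : R) :
  (forall s t, `|f t - f s| <= L * `|t - s|) ->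
  {ae @lebesgue_measure R, forall t, derivable f t 1}.
Proof.
(* [f] is divided by this bound below, and [L] need not be positive. *)
move=> fL; pose M := `|L| + 1; have M0 : 0 < M by rewrite ltr_wpDl.
have fM s t : s <= t -> `|f t - f s| <= M * (t - s).
  move=> st; apply: le_trans (fL _ _) _; rewrite ger0_norm ?subr_ge0//.
  rewrite ler_wpM2r ?subr_ge0// (le_trans (ler_norm _))// lerDl//.
have fc : continuous f.
  move=> t; apply/cvgrPdist_lt => /= e e0; near=> s.
  have : `|t - s| < e / M by near: s; apply/nbhs_ballP;
    exists (e / M) => /=; rewrite ?divr_gt0.
  rewrite ltr_pdivlMr// mulrC; apply: le_lt_trans.
  have [st|/ltW ts] := leP s t.
    by rewrite (le_trans (fM _ _ st))// ger0_norm ?subr_ge0.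
  rewrite distrC (le_trans (fM _ _ ts))// distrC ger0_norm ?subr_ge0//.
(* The identity is the sum of the nondecreasing functions gs 1 and gs (-1), so
   the Stieltjes measure of gs 1 has a density. *)
pose gs (s : R) := fun t => (t + s * f t / M) / 2.
have gnd s : `|s| = 1 -> nondecreasing (gs s).
  move=> s1 x y xy; rewrite /gs ler_pM2r ?invr_gt0// -subr_ge0.
  have -> : y + s * f y / M - (x + s * f x / M) = (y - x) + s * (f y - f x) / M.
    by rewrite !mulrBr mulrBl; ring.
  have : `|s * (f y - f x) / M| <= y - x.
    by rewrite !normrM s1 mul1r normfV (gtr0_norm M0) ler_pdivrMr// mulrC fM.
  by rewrite ler_norml => /andP[]; rewrite lerNl -subr_ge0 opprK addrC.
have gc s : right_continuous (gs s).
  apply: right_continuousW => x; apply: cvgMl; apply: cvgD; first exact: cvg_id.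
  by apply: cvgMl; apply: cvgMr; exact: fc.
have n1 : `|1 : R| = 1 by rewrite normr1.
have n2 : `|-1 : R| = 1 by rewrite normrN1.
pose G : cumulative R R := HB.pack (gs 1)
  (isCumulative.Build R _ R (gs 1) (gnd _ n1) (gc 1)).
pose H : cumulative R R := HB.pack (gs (-1))
  (isCumulative.Build R _ R (gs (-1)) (gnd _ n2) (gc (-1))).
have GH t : G t + H t = t by rewrite /G /H /= /gs; field; rewrite gt_eqF.
(* Densities exist on bounded intervals only; countably many of them exhaust the line. *)
have : {ae @lebesgue_measure R, forall t (k : nat),
    - k%:R < t < k%:R -> derivable (G : R -> R) t 1}.
  apply: ae_foralln => k; exact: (cumulative_derivable_ae _ _ GH).
apply: (@filterS _ _ (ae_filter_ringOfSetsType _)) => t /(_ (Num.bound t)) dG.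
have -> : f = (fun t => 2 * M * G t - M * t).
  by apply/funext => x; rewrite /G/= /gs; field; rewrite gt_eqF.
apply: derivableB; apply: derivableM => //.
apply: dG; rewrite -ltr_norml; exact: unstable.ltr_norm_bound.
Unshelve. all: by end_near. Qed.

(** * Euclidean geometry *)

Lemma cV_bounded_closed_compact (R : realType) n (A : set 'cV[R]_n) :
  bounded_set A -> closed A -> compact A.
Proof.
move=> [M [Mreal normAltM]] Acl.
have Mnco : compact
    [set v : 'rV[R]_n | forall i, v ord0 i \in `[(- (M + 1)), (M + 1)]].
  apply: (@rV_compact _  _ (fun=> `[(- (M + 1)), (M + 1)]%classic)).
  by move=> _; apply: segment_compact.
have trc : continuous (fun v : 'rV[R]_n => v^T : 'cV[R]_n).
  move=> v /= B /nbhs_ballP[e /= e0 eB]; apply/nbhs_ballP; exists e => //= w [_ vw].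
  by apply: eB; split => // i j; rewrite !mxE; exact: vw.
have := continuous_compact (continuous_subspaceT trc) Mnco.
move=> /(subclosed_compact Acl); apply => v Av.
exists v^T; last by rewrite trmxK.
move=> i; rewrite mxE; suff : `|v i ord0 : R| <= M + 1 by rewrite ler_norml in_itv.
have : `|v| <= M + 1 by apply: normAltM Av; rewrite ltrDl.
apply: le_trans.
rewrite [leRHS]/Num.norm /= mx_normrE; apply/bigmax_geP; right => /=.
by exists (i, ord0).
Qed.

Lemma continuous_sum (R : realType) (T : topologicalType) (I : Type)
    (r : seq I) (f : I -> T -> R) :
  (forall i, continuous (f i)) -> continuous (fun x => \sum_(i <- r) f i x).
Proof.
move=> cf; elim: r => [|i r IH] x.
  by under eq_fun do rewrite big_nil; exact: cvg_cst.
by under eq_fun do rewrite big_cons; apply: cvgD; [exact: cf|exact: IH].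
Qed.

Lemma continuous_mul (R : realType) (T : topologicalType) (f g : T -> R) :
  continuous f -> continuous g -> continuous (fun x => f x * g x).
Proof. by move=> cf cg x; apply: cvgM; [exact: cf|exact: cg]. Qed.

Lemma continuous_add (R : realType) (T : topologicalType) (f g : T -> R) :
  continuous f -> continuous g -> continuous (fun x => f x + g x).
Proof. by move=> cf cg x; apply: cvgD; [exact: cf|exact: cg]. Qed.

Definition dot (R : realType) n (g v : 'cV[R]_n) : R := (g^T *m v) 0 0.

Section dot.
Context {R : realType} {n : nat}.
Implicit Types g u v w : 'cV[R]_n.

Lemma dotE g v : dot g v = \sum_i g i 0 * v i 0.
Proof. by rewrite /dot mxE; apply: eq_bigr => i _; rewrite mxE. Qed.

Lemma dotC g v : dot g v = dot v g.
Proof. by rewrite !dotE; apply: eq_bigr => i _; rewrite mulrC. Qed.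

Lemma dotDr g u v : dot g (u + v) = dot g u + dot g v.
Proof. by rewrite /dot mulmxDr mxE. Qed.

Lemma dotNr g v : dot g (- v) = - dot g v.
Proof. by rewrite /dot mulmxN mxE. Qed.

Lemma dotBr g u v : dot g (u - v) = dot g u - dot g v.
Proof. by rewrite dotDr dotNr. Qed.

Lemma dotZr g a v : dot g (a *: v) = a * dot g v.
Proof. by rewrite /dot -scalemxAr mxE. Qed.

Lemma dotZl g a v : dot (a *: g) v = a * dot g v.
Proof. by rewrite dotC dotZr dotC. Qed.

Lemma dotNl g v : dot (- g) v = - dot g v.
Proof. by rewrite dotC dotNr dotC. Qed.

Lemma dot0r g : dot g 0 = 0.
Proof. by rewrite /dot mulmx0 mxE. Qed.

Lemma dotvvB u v : dot (u - v) (u - v) = dot u u - 2 * dot u v + dot v v.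
Proof.
rewrite dotBr [dot (u - v) u]dotC [dot (u - v) v]dotC !dotBr (dotC v u).
ring.
Qed.

Lemma dotvv_ge0 v : 0 <= dot v v.
Proof. by rewrite dotE sumr_ge0// => i _; rewrite -expr2 sqr_ge0. Qed.

Lemma dotvv_gt0 v : v != 0 -> 0 < dot v v.
Proof.
move=> v0; rewrite lt_def dotvv_ge0 andbT; apply: contra v0 => /eqP.
rewrite dotE => /psumr_eq0P dv; apply/eqP/matrixP => i j; rewrite ord1 mxE.
have /eqP := dv (fun i _ => sqr_ge0 (v i 0)) i isT.
by rewrite mulf_eq0 orbb => /eqP.
Qed.

Lemma norm_coord v i : `|v i 0| <= `|v|.
Proof.
rewrite [leRHS]/Num.norm /= mx_normrE; apply/bigmax_geP; right => /=.
by exists (i, ord0).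
Qed.

Lemma norm_dot_le g v : `|dot g v| <= (\sum_i `|g i 0|) * `|v|.
Proof.
rewrite dotE mulr_suml; apply: le_trans (ler_norm_sum _ _ _) _.
by apply: ler_sum => i _; rewrite normrM ler_wpM2l// norm_coord.
Qed.

Lemma dot_continuous g : continuous (dot g).
Proof.
rewrite (_ : dot g = fun w => \sum_i g i 0 * w i 0); last first.
  by apply/funext => w; rewrite dotE.
by apply: continuous_sum => i; apply: continuous_mul;
  [exact: cst_continuous|exact: coord_continuous].
Qed.

Lemma dotvv_continuous u : continuous (fun w : 'cV[R]_n => dot (w - u) (w - u)).
Proof.
rewrite (_ : (fun _ => _) =
    fun w => \sum_i (w i 0 - u i 0) * (w i 0 - u i 0)); last first.
  by apply/funext => w; rewrite dotE; apply: eq_bigr => i _; rewrite !mxE.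
have ci i : continuous (fun w : 'cV[R]_n => w i 0 - u i 0).
  apply: (continuous_add (@coord_continuous _ _ _ i 0)); exact: cst_continuous.
by apply: continuous_sum => i; exact: continuous_mul.
Qed.

Lemma convex_setE (K : set 'cV[R]_n) u v (a : R) : convex_set K ->
  K u -> K v -> 0 <= a <= 1 -> K (u + a *: (v - u)).
Proof.
move=> cK Ku Kv a01.
have := cK v u (Itv01 (andP a01).1 (andP a01).2) (mem_set Kv) (mem_set Ku).
rewrite inE; congr (K _); rewrite /conv/= /unstable.onem scalerBl scale1r scalerBr.
by rewrite addrCA addrA -addrA addrC.
Qed.

(** The normal is [v - w0], where [w0] is the point of [K] nearest to [v] in the Euclidean sense,
    and the gap is its squared length. If the angle at [w0] towards some [w] of [K] were acute, a
    step towards [w] would come closer to [v]. *)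
Lemma compact_convex_separation (K : set 'cV[R]_n) v :
  K !=set0 -> compact K -> convex_set K -> ~ K v ->
  exists g, exists2 c : R, 0 < c & forall w, K w -> dot g w + c <= dot g v.
Proof.
move=> K0 cK vK Kv.
have [w0 /set_mem Kw0 min] := compact_EVT_min K0 cK
  (continuous_subspaceT (@dotvv_continuous v)).
have d0 : v - w0 != 0.
  by rewrite subr_eq0; apply: contra_notN Kv => /eqP ->.
exists (v - w0), (dot (v - w0) (v - w0)); first exact: dotvv_gt0.
move=> w Kw; rewrite -subr_ge0.
suff h : dot (v - w0) (w - w0) <= 0.
  rewrite [X in _ <= _ - (_ + X)]dotBr.
  by move: h; rewrite dotBr; lra.
rewrite leNgt; apply/negP => h.
set p := dot (v - w0) (w - w0) in h.
pose q := dot (w - w0) (w - w0).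
have q0 : 0 <= q by exact: dotvv_ge0.
(* A step of length [a] changes the squared distance by [- 2 * a * p + a ^+ 2 * q], which is
   negative because [a * q < p]; also [a <= 1], so the step stays in [K]. *)
pose a := p / (p + q).
have pq : 0 < p + q by rewrite ltr_wpDr.
have a0 : 0 < a by rewrite divr_gt0.
have a1 : a <= 1 by rewrite ler_pdivrMr// mul1r lerDl.
have := min _ (mem_set (convex_setE vK Kw0 Kw (introT andP (conj (ltW a0) a1)))).
have -> : w0 + a *: (w - w0) - v = a *: (w - w0) - (v - w0).
  by rewrite opprB addrA (addrC w0).
rewrite [leRHS]dotvvB !dotZr !dotZl -(opprB v w0) dotNr dotNl opprK -/q
  (dotC (w - w0)) -/p.
suff : a * (a * q) < a * p by move: (dot (v - w0) (v - w0)) => z; nra.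
rewrite ltr_pM2l// /a mulrAC ltr_pdivrMr// ltr_pM2l//; lra.
Qed.

End dot.

(** * Clarke derivative and gradient *)

Definition sublinear (R : realType) n (p : 'cV[R]_n -> R) : Prop :=
  (forall u v, p (u + v) <= p u + p v) /\
  (forall t u, 0 <= t -> p (t *: u) = t * p u).

(** * The Hahn-Banach theorem in finite dimension *)

Section hahn_banach.
Context {R : realType} {n : nat}.
Implicit Types (p q : 'cV[R]_n -> R) (u v w : 'cV[R]_n).

Lemma sublinear0 p : sublinear p -> p 0 = 0.
Proof. by move=> [_ pZ]; rewrite -(scale0r 0) pZ// mul0r. Qed.

Lemma sublinearN p u : sublinear p -> - p (- u) <= p u.
Proof.
move=> sp; rewrite lerNl -subr_ge0 opprK addrC.
by rewrite -(sublinear0 sp) -(subrr u) (sp.1 u).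
Qed.

(** Where [p] is odd a sublinear minorant has no freedom, being squeezed between [- p (- u)] and
    [p u]. Linearity gained in one direction therefore survives later reductions. *)
Lemma sublinear_le_odd p q u : sublinear q -> (forall w, q w <= p w) ->
  p (- u) = - p u -> q u = p u /\ q (- u) = - p u.
Proof.
move=> sq qp pN; have := sublinearN u sq; have := qp u; have := qp (- u).
by rewrite pN => h1 h2 h3; split; lra.
Qed.

(** The minorant is the infimum over [t >= 0] of [p (w + t *: v) - t * p v]. Taking [t = 0] puts it
    below [p], and [t = 1] at [- v] gives [q (- v) <= - p v], which forces oddness along [v]. *)
Lemma sublinear_linearize p v : sublinear p ->
  exists q, [/\ sublinear q, forall w, q w <= p w, q v = p v & q (- v) = - p v].
Proof.
move=> sp; pose E w := [set p (w + t *: v) - t * p v | t in [set t | 0 <= t]].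
have E0 w : E w !=set0 by exists (p (w + 0 *: v) - 0 * p v), 0 => /=.
have Elb w : has_lbound (E w).
  exists (- p (- w)) => _ [t /= t0 <-].
  have := sp.1 (w + t *: v) (- w); rewrite addrAC subrr add0r sp.2//.
  lra.
pose q w := inf (E w).
have qle w t : 0 <= t -> q w <= p (w + t *: v) - t * p v.
  by move=> t0; apply: ge_inf => //; exists t.
have leq w a : (forall t, 0 <= t -> a <= p (w + t *: v) - t * p v) -> a <= q w.
  by move=> h; apply: lb_le_inf => // _ [t /= t0 <-]; exact: h.
have q0 : q 0 = 0.
  apply/eqP; rewrite eq_le; apply/andP; split.
    by have := qle 0 0 (lexx _); rewrite scale0r addr0 mul0r subr0 (sublinear0 sp).
  by apply: leq => t t0; rewrite add0r sp.2// subrr.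
have qZ t u : 0 < t -> q (t *: u) <= t * q u.
  move=> t0; rewrite mulrC -ler_pdivrMr//; apply: leq => s s0.
  rewrite ler_pdivrMr//.
  have := qle (t *: u) (t * s) (mulr_ge0 (ltW t0) s0).
  rewrite -scalerA -scalerDr sp.2 ?(ltW t0)//.
  by congr (_ <= _); ring.
have sq : sublinear q.
  split=> [u w|t u].
    rewrite -lerBlDr; apply: (leq u) => t t0; rewrite lerBlDr -lerBlDl.
    apply: (leq w) => s s0; rewrite lerBlDl.
    have := qle (u + w) (t + s) (addr_ge0 t0 s0).
    have := sp.1 (u + t *: v) (w + s *: v).
    rewrite addrACA -scalerDl; lra.
  rewrite le_eqVlt => /predU1P[<-|t0]; first by rewrite scale0r mul0r.
  apply/eqP; rewrite eq_le qZ//=.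
  have := qZ t^-1 (t *: u); rewrite invr_gt0 t0 scalerA mulVf ?gt_eqF// scale1r.
  by move=> /(_ isT); rewrite mulrC ler_pdivlMr// mulrC.
have qp w : q w <= p w.
  by have := qle w 0 (lexx _); rewrite scale0r addr0 mul0r subr0.
have qNv : q (- v) <= - p v.
  have := qle (- v) 1 ler01.
  by rewrite scale1r addNr (sublinear0 sp) mul1r sub0r.
have := sublinearN v sq; have := qp v => h1 h2.
by exists q; split => //; lra.
Qed.

Lemma sublinear_linearize_seq p (vs : seq 'cV[R]_n) : sublinear p ->
  exists q, [/\ sublinear q, forall w, q w <= p w &
                forall u, u \in vs -> q (- u) = - q u].
Proof.
move=> sp; elim: vs => [|v vs [q [sq qp qvs]]]; first by exists p; split.
have [q' [sq' q'q q'v q'Nv]] := sublinear_linearize v sq.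
exists q'; split => //; first by move=> w; exact: le_trans (q'q w) (qp w).
move=> u; rewrite inE => /predU1P[->|/qvs qu]; first by rewrite q'v.
by have [-> ->] := sublinear_le_odd sq' q'q qu.
Qed.

(** Linearizing along [v] first fixes the value [p v], which the reductions along the basis vectors
    then keep. The last minorant is odd on the basis, and its values there are the coordinates of
    [g]. *)
Lemma hahn_banach p v : sublinear p ->
  exists g, (forall w, dot g w <= p w) /\ dot g v = p v.
Proof.
move=> sp; have [q0 [sq0 q0p q0v q0Nv]] := sublinear_linearize v sp.
pose e i : 'cV[R]_n := delta_mx i 0.
have [q [sq qq0 qe]] := sublinear_linearize_seq [seq e i | i <- enum 'I_n] sq0.
have {}qe i : q (- e i) = - q (e i).
  by apply: qe; apply/mapP; exists i => //; rewrite mem_enum.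
have qZe t i : q (t *: e i) = t * q (e i).
  have [t0|t0] := leP 0 t; first exact: sq.2.
  by rewrite -[t]opprK scaleNr -scalerN sq.2 ?oppr_ge0 ?ltW// qe mulrNN opprK.
have qsum (r : seq 'I_n) (f : 'I_n -> 'cV[R]_n) :
    q (\sum_(i <- r) f i) <= \sum_(i <- r) q (f i).
  elim: r => [|i r IH]; first by rewrite !big_nil (sublinear0 sq).
  by rewrite !big_cons (le_trans (sq.1 _ _))// lerD2l.
have gq w : dot (\col_i q (e i)) w <= q w.
  apply: le_trans (sublinearN w sq); rewrite lerNr dotE.
  have -> : - w = \sum_i (- w i 0) *: e i.
    apply/matrixP => i j; rewrite ord1 mxE summxE (bigD1 i)//= big1 ?addr0.
      by rewrite !mxE !eqxx mulr1.
    by move=> k ki; rewrite !mxE eq_sym (negbTE ki) mulr0.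
  apply: le_trans (qsum _ _) _; rewrite -sumrN; apply: ler_sum => i _.
  by rewrite qZe mxE mulNr mulrC.
exists (\col_i q (e i)); split=> [w|].
  by rewrite (le_trans (gq w))// (le_trans (qq0 w)).
have q0N : q0 (- v) = - q0 v by rewrite q0v.
have [qv qNv] := sublinear_le_odd sq qq0 q0N.
have := gq v; have := gq (- v); rewrite dotNr qv qNv q0v; lra.
Qed.

End hahn_banach.

Lemma filter_prod_nbhs_rightP (R : realType) n (x : 'cV[R]_n)
    (A : set ('cV[R]_n * R)) :
  filter_prod (nbhs x) (0 : R)^'+ A <->
  exists2 d : R, 0 < d &
    forall z s, `|z - x| < d -> 0 < s < d -> A (z, s).
Proof.
split=> [[[P Q] /= [/nbhs_ballP[e /= e0 eP] [f /= f0 fQ]] PQ]|[d d0 dA]].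
  exists (Num.min e f); first by rewrite lt_min e0.
  move=> z s; rewrite !lt_min => /andP[ze _] /and3P[s0 _ sf].
  apply: (PQ (z, s)); split => /=.
    by apply: eP; rewrite -ball_normE /= distrC.
  by apply: fQ => //=; rewrite sub0r normrN gtr0_norm.
exists (ball x d, [set s | 0 < s < d]) => /=.
  split; first by apply/nbhs_ballP; exists d.
  exists d => // s /=; rewrite sub0r normrN => sd s0.
  by rewrite s0 -(gtr0_norm s0).
by move=> [z s] [/=]; rewrite -ball_normE /= distrC; exact: dA.
Qed.

Section clarke.
Context {R : realType} {n : nat} (V : 'cV[R]_n -> R) (x : 'cV[R]_n).

Lemma clarke_derivative_lt v a : (clarke_derivative V x v < a%:E)%E ->
  exists2 d : R, 0 < d & forall z s, `|z - x| < d -> 0 < s < d ->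
    V (z + s *: v) - V z < a * s.
Proof.
move=> /ereal_inf_lt[_ [A /filter_prod_nbhs_rightP[d d0 dA] <-] supA].
exists d => // z s zd sd; rewrite -ltr_pdivrMr ?(andP sd).1//.
rewrite -lte_fin; apply: le_lt_trans supA; apply: ereal_sup_ubound.
by exists (z, s); [exact: dA|].
Qed.

Lemma clarke_derivative_le v a :
  (forall e, 0 < e -> exists2 d : R, 0 < d & forall z s, `|z - x| < d ->
     0 < s < d -> V (z + s *: v) - V z <= (a + e) * s) ->
  (clarke_derivative V x v <= a%:E)%E.
Proof.
move=> h; apply/lee_addgt0Pr => e e0; have [d d0 hd] := h e e0.
apply: le_trans (ereal_inf_lbound _) _.
  exists [set p | `|p.1 - x| < d /\ 0 < p.2 < d] => //.
  by apply/filter_prod_nbhs_rightP; exists d.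
apply: ge_ereal_sup => _ [[z s] /= [zx sd] <-].
by rewrite -EFinD lee_fin ler_pdivrMr ?(andP sd).1//; exact: hd.
Qed.

Lemma clarke_derivative_ge v a :
  (forall d, 0 < d -> exists z s, [/\ `|z - x| < d, 0 < s < d &
     a * s <= V (z + s *: v) - V z]) ->
  (a%:E <= clarke_derivative V x v)%E.
Proof.
move=> h; apply: le_ereal_inf_tmp => _ [A /filter_prod_nbhs_rightP[d d0 dA] <-].
have [z [s [zx sd zs]]] := h d d0.
apply: le_trans (ereal_sup_ubound _); last by exists (z, s); [exact: dA|].
by rewrite lee_fin ler_pdivlMr ?(andP sd).1.
Qed.

Context (L r : R) (r0 : 0 < r).
Context (VL : forall z w, `|z - x| < r -> `|w - x| < r ->
  `|V z - V w| <= L * `|z - w|).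

(** The radius [r / 2] leaves room for replacing the direction [v] by a nearby one. *)
Let small (v : 'cV[R]_n) : exists2 d : R, 0 < d & forall z s, `|z - x| < d ->
  0 < s < d -> `|z - x| < r /\ `|z + s *: v - x| < r / 2.
Proof.
exists (r / (4 * (1 + `|v|))).
  by rewrite divr_gt0// mulr_gt0// ltr_pwDl.
set d := r / (4 * _) => z s zx /andP[s0 sd].
have d2 : d * (1 + `|v|) <= r / 4.
  by rewrite /d invfM mulrA mulfVK// gt_eqF// ltr_pwDl.
have d0 : 0 < d by exact: lt_trans sd.
have v0 : 0 <= d * `|v| by rewrite mulr_ge0// ltW.
have sv : s * `|v| <= d * `|v| by rewrite ler_wpM2r// ltW.
split; first lra.
rewrite addrAC (le_lt_trans (ler_normD _ _))// normrZ (gtr0_norm s0).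
lra.
Qed.

(** The Lipschitz bound confines the quotients. For the lower bound on the limsup, quotients based
    at [x] itself suffice. *)
Lemma clarke_derivative_fin v : clarke_derivative V x v \is a fin_num.
Proof.
have [d d0 dV] := small v.
have bnd z s : `|z - x| < d -> 0 < s < d -> `|V (z + s *: v) - V z| <= L * `|v| * s.
  move=> zx sd; have [h1 h2] := dV z s zx sd.
  have {}h2 : `|z + s *: v - x| < r by apply: lt_trans h2 _; move: r0; lra.
  rewrite (le_trans (VL h2 h1))//.
  by rewrite addrAC subrr add0r normrZ gtr0_norm ?(andP sd).1// -mulrA (mulrC s).
have up : (clarke_derivative V x v <= (L * `|v|)%:E)%E.
  apply: clarke_derivative_le => e e0; exists d => // z s zx sd.
  rewrite (le_trans (ler_norm _))// (le_trans (bnd _ _ zx sd))// ler_wpM2r//.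
    by rewrite ltW// (andP sd).1.
  by rewrite lerDl ltW.
have lo : ((- (L * `|v|))%:E <= clarke_derivative V x v)%E.
  apply: clarke_derivative_ge => e e0; exists x, (Num.min d e / 2).
  have m0 : 0 < Num.min d e by rewrite lt_min d0.
  have me : Num.min d e / 2 < Num.min d e by rewrite ltr_pdivrMr// ltr_pMr// ltr1n.
  have [md mee] : Num.min d e <= d /\ Num.min d e <= e by rewrite !ge_min !lexx orbT.
  split; first by rewrite subrr normr0.
    by rewrite divr_gt0//= (lt_le_trans me).
  rewrite mulNr lerNl (le_trans _ (bnd x _ _ _))//.
  - by rewrite -normrN ler_norm.
  - by rewrite subrr normr0.
  - by rewrite divr_gt0//= (lt_le_trans me).
by rewrite fin_numElt (lt_le_trans _ lo) ?ltNyr// (le_lt_trans up)// ltry.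
Qed.

Let p v := fine (clarke_derivative V x v).

Let pE v : clarke_derivative V x v = (p v)%:E.
Proof. by rewrite /p fineK// clarke_derivative_fin. Qed.

Let p_lt v e : 0 < e -> exists2 d : R, 0 < d & forall z s, `|z - x| < d ->
  0 < s < d -> V (z + s *: v) - V z < (p v + e) * s.
Proof. by move=> e0; apply: clarke_derivative_lt; rewrite pE lte_fin ltrDl. Qed.

Let p_le v a : (forall e, 0 < e -> exists2 d : R, 0 < d & forall z s,
  `|z - x| < d -> 0 < s < d -> V (z + s *: v) - V z <= (a + e) * s) -> p v <= a.
Proof. by move=> /clarke_derivative_le; rewrite pE lee_fin. Qed.

(** For subadditivity the increment along [u + w] is split at [z + s *: w]. The first part is then
    based at a shifted point, which is harmless because the limsup ranges over base points too. *)
Lemma clarke_derivative_sublinear : sublinear p.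
Proof.
have pZ t u : 0 < t -> p (t *: u) <= t * p u.
  move=> t0; apply: p_le => e e0.
  have [d d0 dP] := p_lt u (divr_gt0 e0 t0).
  exists (Num.min d (d / t)); first by rewrite lt_min d0 divr_gt0.
  move=> z s; rewrite !lt_min => /andP[zd _] /and3P[s0 _ sd].
  rewrite scalerA mulrC; have := dP z (t * s) zd.
  rewrite mulr_gt0//= mulrC -ltr_pdivlMr// => /(_ sd) /ltW /le_trans; apply.
  rewrite le_eqVlt; apply/orP; left; apply/eqP; field; exact: lt0r_neq0.
have p0 : p 0 = 0.
  apply/eqP; rewrite eq_le; apply/andP; split.
    apply: p_le => e e0; exists 1 => // z s _ /andP[s0 _].
    by rewrite scaler0 addr0 subrr add0r mulr_ge0 ?ltW.
  rewrite -lee_fin -pE; apply: clarke_derivative_ge => d d0; exists x, (d / 2).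
  rewrite subrr normr0 scaler0 addr0 subrr mul0r d0 divr_gt0//=.
  by rewrite ltr_pdivrMr// ltr_pMr// ltr1n.
split=> [u w|t u].
  apply: p_le => e e0; have e20 : 0 < e / 2 by rewrite divr_gt0.
  have [d1 d10 h1] := p_lt u e20; have [d2 d20 h2] := p_lt w e20.
  (* This keeps the shifted base point [z + s *: w] within [d1] of [x]. *)
  pose d := d1 / (1 + `|w|).
  have w0 : 0 < 1 + `|w| by rewrite ltr_pwDl.
  have dd1 : d <= d1 by rewrite ler_pdivrMr// ler_peMr ?lerDl ?(ltW d10).
  have dE : d * (1 + `|w|) = d1 by rewrite mulfVK// gt_eqF.
  exists (Num.min (d / 2) d2); first by rewrite lt_min d20 !divr_gt0.
  have d0 : 0 < d by rewrite divr_gt0.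
  move=> z s; rewrite !lt_min => /andP[zd zd2] /and3P[s0 sd sd2].
  have {h2} := h2 z s zd2; rewrite s0 sd2 => /(_ isT).
  have {h1} := h1 (z + s *: w) s; rewrite s0/= (lt_le_trans sd) => [|]; last by lra.
  rewrite addrAC (le_lt_trans (ler_normD _ _)); last first.
    rewrite normrZ gtr0_norm//.
    have : s * `|w| <= d / 2 * `|w| by rewrite ler_wpM2r// ltW.
    by move: dE; lra.
  move=> /(_ isT isT).
  rewrite -addrA -scalerDr (addrC w) => a1 a2.
  have -> : (p u + p w + e) * s = (p u + e / 2) * s + (p w + e / 2) * s by field.
  by apply: ltW; move: (ltrD a1 a2); rewrite addrA subrK.
rewrite le_eqVlt => /predU1P[<-|t0]; first by rewrite scale0r mul0r.
apply/eqP; rewrite eq_le pZ//=.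
have := pZ t^-1 (t *: u); rewrite invr_gt0 t0 scalerA mulVf ?gt_eqF// scale1r.
by move=> /(_ isT); rewrite mulrC ler_pdivlMr// mulrC.
Qed.

(** A gradient attaining the directional derivative shows that the latter is below [k]. Half of the
    gap is kept for perturbing the direction, so the bound also holds for all [w] near [v]. *)
Lemma clarke_decrease v k :
  (forall g, clarke_gradient V x g -> dot g v < k) ->
  exists2 d : R, 0 < d & forall z w s, `|z - x| < d -> `|w - v| < d ->
    0 < s < d -> V (z + s *: w) - V z <= (k - d) * s.
Proof.
move=> gk; have [g [gp gv]] := hahn_banach v clarke_derivative_sublinear.
have {}gk : p v < k.
  by rewrite -gv; apply: gk => w; rewrite pE lee_fin; exact: gp.
pose e := (k - p v) / 2.
have e0 : 0 < e by rewrite divr_gt0// subr_gt0.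
have [d1 d10 h1] := p_lt v e0; have [d2 d20 h2] := small v.
pose M := `|L| + 1.
have M0 : 0 < M by rewrite ltr_wpDl.
(* The last term makes the Lipschitz cost of changing the direction by [d], plus the announced
   margin [d], at most [e / 2]; the others keep every point in the ball where [V] is Lipschitz. *)
pose d := Num.min (Num.min 1 (r / 4)) (Num.min (Num.min (d1 / 2) (d2 / 2)) (e / (2 * M))).
have d0 : 0 < d.
  by rewrite !lt_min ltr01 !divr_gt0 ?mulr_gt0 ?subr_gt0.
exists d => // z w s zx wv /andP[s0 sd].
have [[dl1 dr] [[dd1 dd2] de]] : ((d <= 1) /\ (d <= r / 4)) /\
    ((d <= d1 / 2 /\ d <= d2 / 2) /\ d <= e / (2 * M)).
  by rewrite /d !ge_min !lexx /= ?orbT.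
have {}de : d * M <= e / 2.
  by rewrite (le_trans (ler_wpM2r (ltW M0) de))// invfM mulrA mulfVK ?gt_eqF.
have [zd1 zd2 sd1 sd2] : [/\ `|z - x| < d1, `|z - x| < d2, s < d1 & s < d2].
  by split; lra.
have {h1} := h1 z s zd1; rewrite s0 => /(_ sd1) h1.
have {h2} := h2 z s zd2; rewrite s0 => /(_ sd2)[h2 h3].
have sw : `|s *: (w - v)| <= s * d.
  by rewrite normrZ gtr0_norm// ler_wpM2l ?(ltW s0) ?(ltW wv).
have sd1' : s * d <= r / 4.
  by rewrite (le_trans _ dr)// ler_piMl ?(ltW d0)// (le_trans (ltW sd)).
have zw : z + s *: w = (z + s *: v) + s *: (w - v).
  by rewrite -addrA -scalerDr subrKC.
have h4 : `|z + s *: w - x| < r.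
  rewrite zw addrAC (le_lt_trans (ler_normD _ _))//.
  by move: sw sd1' h3; lra.
have h5 : `|z + s *: v - x| < r by lra.
have := VL h4 h5; rewrite {2}zw addrAC subrr add0r => h6.
have {}h6 : V (z + s *: w) - V (z + s *: v) <= `|L| * (s * d).
  rewrite (le_trans (ler_norm _))// (le_trans h6)//.
  rewrite (le_trans (ler_wpM2r _ (ler_norm L)))//.
  by rewrite ler_wpM2l.
have : s * (d * M) <= s * (e / 2) by rewrite ler_wpM2l// ltW.
have : p v + e = k - e by rewrite /e; field.
by move: h1 h6; rewrite /M; nra.
Qed.

End clarke.

(** * Absolutely continuous functions *)

(** The supremum of the [u] such that [P a u] is attained and cannot lie before [b]. Local intervals
    are only required to contain [t], as in the tagged partitions of Cousin's lemma, because
    derivability at [t] controls exactly these. *)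
Lemma cousin (R : realType) (P : R -> R -> Prop) (a b : R) : a <= b ->
  (forall s t u, a <= s -> s <= t -> t <= u -> u <= b ->
     P s t -> P t u -> P s u) ->
  (forall t, a <= t <= b -> exists2 d : R, 0 < d & forall s u,
     a <= s -> s <= t -> t <= u -> u <= b -> u - s < d -> P s u) ->
  P a b.
Proof.
move=> ab Padd Ploc; pose S := [set u | a <= u <= b /\ P a u].
have Sa : S a.
  split; first by rewrite lexx.
  have [d d0] := Ploc a (introT andP (conj (lexx a) ab)).
  by apply; rewrite ?subrr.
have ubS : ubound S b by move=> u [/andP[]].
have supS : has_sup S by split; [exists a | exists b].
set c := sup S.
have cb : c <= b by apply: ge_sup => //; exists a.
have ac : a <= c by apply: ub_le_sup => //; exists b.
have [d d0 dP] := Ploc c (introT andP (conj ac cb)).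
have d2 : 0 < d / 2 by rewrite divr_gt0.
have Pac : P a c.
  have [u [/andP[au ub] Pu] cu] := sup_adherent d2 supS.
  have uc : u <= c by apply: ub_le_sup; [exists b|split; rewrite ?au].
  apply: (Padd a u c) => //; apply: dP => //.
  by move: cu; rewrite -/c; lra.
pose u := Num.min b (c + d / 2).
have cu : c <= u by rewrite le_min cb lerDl ltW.
have ub : u <= b by rewrite ge_min lexx.
have Su : S u.
  split; first by rewrite ub (le_trans ac).
  apply: (Padd a c u) => //; apply: dP => //.
  have : u <= c + d / 2 by rewrite ge_min lexx orbT.
  lra.
have uc : u <= c by apply: ub_le_sup => //; exists b.
suff -> : b = c by [].
apply/eqP; rewrite eq_le cb andbT leNgt; apply/negP => cb'.
by move: uc; rewrite leNgt /u lt_min cb' ltrDl d2.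
Qed.

Section interval_chain.
Context {R : realType}.
Implicit Types (s t u : R) (l : seq (R * R)).

(** Ordered intervals between [s] and [u], with gaps allowed: only the bad intervals will be
    recorded. Thanks to the order, joining two adjacent intervals of time is concatenation. *)
Fixpoint interval_chain s l u : Prop :=
  if l is p :: l' then s <= p.1 /\ p.1 <= p.2 /\ interval_chain p.2 l' u
  else s <= u.

Lemma interval_chain_le s l u : interval_chain s l u -> s <= u.
Proof.
elim: l s => [//|p l IH] s /= [sp [pp /IH]].
exact: le_trans (le_trans sp pp).
Qed.

Lemma interval_chain_lel s t l u : s <= t ->
  interval_chain t l u -> interval_chain s l u.
Proof.
by case: l => [|p l] /= st; [exact: le_trans|move=> [/(le_trans st)]].
Qed.

Lemma interval_chain_cat s l t l' u : interval_chain s l t ->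
  interval_chain t l' u -> interval_chain s (l ++ l') u.
Proof.
elim: l s => [|p l IH] s /=; first exact: interval_chain_lel.
by move=> [sp [pp /IH{}IH]] /IH.
Qed.

Lemma interval_chain_nth s l u i : interval_chain s l u -> (i < size l)%N ->
  let p := nth (0, 0) l i in s <= p.1 /\ p.1 <= p.2 /\ p.2 <= u.
Proof.
elim: l s i => [//|p l IH] s [|i] /= [sp [pp h]] il.
  by rewrite (interval_chain_le h).
have [h1 h2] := IH _ i h il.
by split => //; rewrite (le_trans sp)// (le_trans pp).
Qed.

Lemma interval_chain_disjoint s l u i j : interval_chain s l u ->
  (i < j)%N -> (j < size l)%N ->
  (nth (0, 0) l i).2 <= (nth (0, 0) l j).1.
Proof.
elim: l s i j => [//|p l IH] s [|i] [|j] //= [_ [_ h]] ij jl.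
  by have [] := interval_chain_nth h jl.
exact: (IH _ i j h).
Qed.

(** Half-open intervals remain disjoint when they share an endpoint, so their measures add up along
    the chain. *)
Lemma interval_chain_measure (U : set R) s l u : open U ->
  interval_chain s l u -> (forall p, p \in l -> `]p.1, p.2]%classic `<=` U) ->
  ((\sum_(p <- l) (p.2 - p.1))%:E <=
   @lebesgue_measure R (U `&` `]s, u]%classic))%E.
Proof.
move=> oU; have mU := open_measurable oU.
elim: l s => [|p l IH] s /=; first by rewrite big_nil measure_ge0.
move=> [sp [pp h]] lU; rewrite big_cons EFinD.
have lenp : ((p.2 - p.1)%:E = @lebesgue_measure R `]p.1, p.2]%classic)%E.
  rewrite lebesgue_measure_itv/= lte_fin; case: ltP => //.
  move=> h1; have -> : p.2 = p.1 by apply/eqP; rewrite eq_le h1.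
  by rewrite subrr.
rewrite lenp.
have hl := IH _ h (fun q ql => lU q (mem_behead (s := p :: l) ql)).
apply: le_trans (leeD2l _ hl) _.
have pu := interval_chain_le h.
rewrite -measureU.
- apply: le_measure; rewrite ?inE.
  + apply: measurableU; first exact: measurable_itv.
    by apply: measurableI => //; exact: measurable_itv.
  + by apply: measurableI => //; exact: measurable_itv.
  + move=> t [tp|[Ut]] /=.
      split; first by apply: (lU p) => //; rewrite inE eqxx.
      move: tp; rewrite /= !in_itv/= => /andP[t1 t2].
      by rewrite (le_lt_trans sp)// (le_trans t2).
    rewrite !in_itv/= => /andP[t1 t2]; split => //.
    by rewrite t2 andbT (le_lt_trans _ t1)// (le_trans sp).
- exact: measurable_itv.
- by apply: measurableI => //; exact: measurable_itv.
- rewrite -subset0 => t [] /=; rewrite !in_itv/= => /andP[_ t1] [_ /andP[t2 _]].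
  by move: t2; rewrite ltNge t1.
Qed.

End interval_chain.

Lemma negligible_open_cover (R : realType) (N : set R) (e : R) :
  (@lebesgue_measure R).-negligible N -> 0 < e ->
  exists U : set R, [/\ open U, N `<=` U & (@lebesgue_measure R U < e%:E)%E].
Proof.
move=> [A [mA A0 NA]] e0.
have Afin : (@lebesgue_measure R A < +oo)%E by rewrite A0.
have [U [oU AU Ue]] := lebesgue_regularity_outer mA Afin e0.
exists U; split => //; first exact: subset_trans AU.
apply: le_lt_trans Ue.
have mU := open_measurable oU.
have mUA : measurable (U `\` A) by exact: measurableD.
apply: (@le_trans _ _ (lebesgue_measure (A `|` U `\` A))).
  apply: le_measure; rewrite ?inE//; first exact: measurableU.
  by move=> t Ut; have [|] := pselect (A t); [left|right].
apply: le_trans (measureU2 _ _ _) _ => //.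
by rewrite [X in (X + _)%E]A0 add0e.
Qed.

(* Off a null set the increments are bounded by hypothesis; the remaining times
   are absorbed by finitely many intervals of small total length, on which phi
   varies little. *)
Lemma absolutely_continuous_decrease (R : realType) n (x : R -> 'cV[R]_n)
    (phi : R -> R) (a b L c : R) : a <= b ->
  absolutely_continuous a b x ->
  (forall s t, a <= s -> s <= t -> t <= b ->
     `|phi t - phi s| <= L * `|x t - x s|) ->
  {ae @lebesgue_measure R, forall t, a < t -> t <= b ->
     forall e : R, 0 < e -> exists2 d : R, 0 < d & forall s u,
       a <= s -> s <= t -> t <= u -> u <= b -> u - s < d ->
       phi u - phi s <= (c + e) * (u - s)} ->
  phi b - phi a <= c * (b - a).
Proof.
move=> ab xac phiL phid; apply/ler_addgt0Pr => e0 e00.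
pose e := e0 / (2 + (b - a)).
have ba : 0 < 2 + (b - a) by rewrite ltr_pwDl// subr_ge0.
have e_gt0 : 0 < e by rewrite divr_gt0.
suff : phi b - phi a <= (c + e) * (b - a) + e + e.
  have : e0 = e * (2 + (b - a)) by rewrite mulfVK// gt_eqF.
  by move=> ->; congr (_ <= _); ring.
have L0 : 0 < `|L| + 1 by rewrite ltr_wpDl.
(* On a bad interval the target [(c + e) * (u - s)] may be negative; [K * (u - s)] compensates for
   it. *)
pose K := `|c + e| + 1.
have K0 : 0 < K by rewrite ltr_wpDl.
have [d1 d10 xd] := xac (e / (`|L| + 1)) (divr_gt0 e_gt0 L0).
pose d := Num.min d1 (e / K).
have d0 : 0 < d by rewrite lt_min d10 divr_gt0.
(* The point [a] is added to the null set, since the hypothesis only speaks of times [t > a]. *)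
have [U [oU NU Ud]] := negligible_open_cover
  (negligibleU phid (ex_intro _ [set a] (And3 (measurable_set1 a)
    (lebesgue_measure_set1 a) (@subset_refl _ _)))) d0.
(* The error charged to the bad intervals. Their total length is below [d], so each of the two sums
   is at most [e]: the first by absolute continuity, the second by the choice of [d]. *)
pose Q l := \sum_(p <- l) (`|phi p.2 - phi p.1| + K * (p.2 - p.1)).
pose P s u := exists l, [/\ interval_chain s l u,
  forall p, p \in l -> `]p.1, p.2]%classic `<=` U &
  phi u - phi s <= (c + e) * (u - s) + Q l].
have [l [hl lU phil]] : P a b.
  apply: cousin => // [s t u _ _ _ _ [l [hl lU phil]] [l' [hl' lU' phil']]|].
    exists (l ++ l'); split; first exact: interval_chain_cat hl hl'.
      by move=> p; rewrite mem_cat => /orP[/lU|/lU'].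
    by rewrite /Q big_cat/= -!/(Q _); move: phil phil'; lra.
  move=> t /andP[at_ tb]; have [Ut|Ut] := pselect (U t).
    have [f /= f0 fU] := oU t Ut.
    exists f => // s u as_ st tu ub us; exists [:: (s, u)]; split => /=.
    - by rewrite lexx (le_trans st).
    - move=> _ /[!inE]/eqP -> v /=; rewrite in_itv/= => /andP[sv vu].
      by apply: fU => /=; rewrite ltr_norml; apply/andP; split; lra.
    - rewrite /Q big_seq1/=.
      have h1 : 0 <= u - s by rewrite subr_ge0 (le_trans st).
      have := ler_norm (phi u - phi s).
      have : - (K * (u - s)) <= (c + e) * (u - s).
        rewrite -mulNr ler_wpM2r// /K lerNl.
        by have := ler_norm (- (c + e)); rewrite normrN; lra.
      lra.
  have ta : a < t.
    by rewrite lt_neqAle at_ andbT; apply: contra_notN Ut => /eqP <-; apply: NU; right.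
  have [f f0 fP] : exists2 d : R, 0 < d & forall s u,
       a <= s -> s <= t -> t <= u -> u <= b -> u - s < d ->
       phi u - phi s <= (c + e) * (u - s).
    apply: contrapT => h; apply: Ut; apply: NU; left => /(_ ta tb e e_gt0).
    exact: h.
  exists f => // s u as_ st tu ub us; exists [::]; split => //=.
    exact: le_trans tu.
  by rewrite /Q big_nil addr0; exact: fP.
have len : \sum_(p <- l) (p.2 - p.1) < d.
  rewrite -lte_fin; apply: le_lt_trans Ud.
  apply: le_trans (interval_chain_measure oU hl lU) _.
  apply: le_measure; rewrite ?inE; [|exact: open_measurable|exact: subIsetl].
  by apply: measurableI; [exact: open_measurable|exact: measurable_itv].
have nthE (f : R * R -> R) : \sum_(p <- l) f p = \sum_(i < size l) f (nth (0, 0) l i).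
  by rewrite (big_nth (0, 0)) big_mkord.
have H := xd (size l) (fun i => (nth (0, 0) l i).1) (fun i => (nth (0, 0) l i).2).
rewrite -(nthE (fun p => p.2 - p.1)) -(nthE (fun p => `|x p.2 - x p.1|)) in H.
have {H} xl : \sum_(p <- l) `|x p.2 - x p.1| < e / (`|L| + 1).
  apply: H.
  - by move=> i; exact: interval_chain_nth hl (ltn_ord i).
  - move=> i j; rewrite -val_eqE neq_ltn => /orP[ij|ij]; [left|right].
      exact: interval_chain_disjoint hl ij (ltn_ord j).
    exact: interval_chain_disjoint hl ij (ltn_ord i).
  - by apply: lt_le_trans len _; rewrite ge_min lexx.
have Ql : Q l <= e + e.
  rewrite /Q big_split/= -mulr_sumr lerD//; last first.
    rewrite mulrC -ler_pdivlMr//; apply: ltW; apply: lt_le_trans len _.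
    by rewrite ge_min lexx orbT.
  move: xl; rewrite ltr_pdivlMr// mulrC mulr_sumr => /ltW; apply: le_trans.
  rewrite !nthE; apply: ler_sum => i _.
  have [h1 [h2 h3]] := interval_chain_nth hl (ltn_ord i).
  apply: le_trans (phiL _ _ h1 h2 h3) _.
  by rewrite ler_wpM2r// (le_trans (ler_norm _))// lerDl.
lra.
Qed.

(** The local hypothesis covers every small [e], so [P] need not be monotone in [e] to pass to a
    common value. *)
Lemma compact_uniform (R : realType) n (K : set 'cV[R]_n)
    (P : R -> 'cV[R]_n -> Prop) : compact K ->
  (forall x, K x -> exists2 d : R, 0 < d &
     forall y e, `|y - x| < d -> 0 < e < d -> P e y) ->
  exists2 e : R, 0 < e & forall y, K y -> P e y.
Proof.
move=> /compact_near_coveringP cK KP.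
have h : \forall e \near (0 : R)^'+, K `<=` P e.
  apply: cK => x /KP[d d0 dP].
  exists (ball x d, [set s | 0 < s < d]) => /=.
    split; first by apply/nbhs_ballP; exists d.
    exists d => // s /=; rewrite sub0r normrN => sd s0.
    by rewrite s0 -(gtr0_norm s0).
  by move=> [z s] [/=]; rewrite -ball_normE /= distrC; exact: dP.
have [d /= d0 dP] := h.
exists (d / 2) => [|y]; first by rewrite divr_gt0.
apply: dP; rewrite ?divr_gt0//= sub0r normrN gtr0_norm ?divr_gt0//.
by rewrite ltr_pdivrMr// ltr_pMr// ltr1n.
Qed.

Lemma within_continuous_dist (R : realType) n (X : set 'cV[R]_n)
    (V : 'cV[R]_n -> R) x (e : R) : {within X, continuous V} -> X x -> 0 < e ->
  exists2 d : R, 0 < d & forall y, X y -> `|y - x| < d -> `|V y - V x| < e.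
Proof.
move=> /subspace_continuousP/(_ x)/[apply] Vx e0.
have /nbhs_ballP[d /= d0 dP] := Vx _ (nbhsx_ballx (V x) e e0).
exists d => // y Xy yx; rewrite distrC.
by have := dP y; rewrite -!ball_normE /= (distrC x) => /(_ yx Xy).
Qed.

Lemma locally_lipschitz_ball (R : realType) n (D : set 'cV[R]_n)
    (V : 'cV[R]_n -> R) x : locally_lipschitz D V -> D x ->
  exists L, exists2 r : R, 0 < r & forall z w, `|z - x| < r -> `|w - x| < r ->
    `|V z - V w| <= L * `|z - w|.
Proof.
move=> /(_ x)/[apply] -[U /nbhs_ballP[r /= r0 rU] VU].
have [M [_ MV]] : \forall M \near +oo, M.-lipschitz_U V by [].
exists (M + 1), r => // z w zx wx.
apply: (MV (M + 1) _ (z, w)); first by rewrite ltrDl.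
by split; apply: rU; rewrite -ball_normE /= distrC.
Qed.

(** * Uniform decrease of [V] near a point *)

Section local_decrease.
Context {R : realType} {n : nat} (F : 'cV[R]_n -> set 'cV[R]_n).
Context (V : 'cV[R]_n -> R).

(** One radius serves all base points, all velocities of [F y] and all directions near them. This
    uniformity lets the property spread from [y] to its neighbours. *)
Definition decreases_at (c : R) (y : 'cV[R]_n) : Prop :=
  exists2 d : R, 0 < d & forall z v w s, `|z - y| < d -> F y v ->
    `|w - v| < d -> 0 < s < d -> V (z + s *: w) - V z <= - c * s.

Lemma decreases_at_le b c y : b <= c -> decreases_at c y -> decreases_at b y.
Proof.
move=> bc [d d0 dP]; exists d => // z v w s zy Fv wv s0.
apply: le_trans (dP z v w s zy Fv wv s0) _.
by rewrite ler_wpM2r ?lerN2// ltW// (andP s0).1.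
Qed.

(** Compactness of [F y] turns the radius and the margin, found for each velocity separately, into
    common ones. *)
Lemma time_derivative_decreases D y k : locally_lipschitz D V -> D y ->
  compact (F y) -> (forall q, time_derivative F V y q -> q < k) ->
  exists2 e : R, 0 < e & decreases_at (e - k) y.
Proof.
move=> VD Dy cF qk; have [L [r r0 VL]] := locally_lipschitz_ball VD Dy.
have [e e0 eP] : exists2 e : R, 0 < e & forall v, F y v -> forall z w s,
    `|z - y| < e -> `|w - v| < e -> 0 < s < e ->
    V (z + s *: w) - V z <= (k - e) * s.
  apply: (compact_uniform cF) => v Fv.
  have [g gv|d d0 dP] := clarke_decrease r0 VL (v := v) (k := k).
    by apply: qk; exists g => //; exists v.
  exists (d / 2); first by rewrite divr_gt0.
  move=> v' e v'v /andP[e0 ed] z w s zy wv' /andP[s0 se].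
  apply: le_trans (dP z w s _ _ _) _; [lra| |by rewrite s0; lra|].
    by have := ler_distD v' w v; lra.
  by rewrite ler_wpM2r ?(ltW s0)//; lra.
exists e => //; exists e => // z v w s zy Fv wv se.
by rewrite opprB; exact: eP Fv z w s zy wv se.
Qed.

(** Upper semicontinuity puts [F z] in the [d / 2]-neighbourhood of [F y]; the other half of [d]
    pays for the deviations around [z]. *)
Lemma decreases_at_near X c y : upper_semicontinuous X F -> X y ->
  decreases_at c y -> exists2 d : R, 0 < d &
    forall z, X z -> `|z - y| < d -> decreases_at c z.
Proof.
move=> usc Xy [d d0 dP]; have d2 : 0 < d / 2 by rewrite divr_gt0.
pose O := \bigcup_(v in F y) ball v (d / 2).
have oO : open O by apply: bigcup_open => v _; exact: ball_open.
have FO : F y `<=` O by move=> v Fv; exists v => //; exact: ballxx.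
have /nbhs_ballP[e /= e0 eF] := usc y Xy O oO FO.
exists (Num.min e (d / 2)); first by rewrite lt_min e0.
move=> z Xz; rewrite lt_min => /andP[ze zd].
have FzO : F z `<=` O by apply: eF => //; rewrite -ball_normE /= distrC.
exists (d / 2) => // z' v w s z'z /FzO[v0 Fv0].
rewrite -ball_normE /= distrC => vv0 wv /andP[s0 sd].
apply: (dP z' v0 w s) => //.
- by have := ler_distD z z' y; lra.
- by have := ler_distD v w v0; lra.
- by rewrite s0; lra.
Qed.

End local_decrease.

(** The straddle lemma: as [s] and [u] lie on the two sides of [t], the errors [e * (u - t)] and
    [e * (t - s)] add up to [e * (u - s)]. *)
Lemma derivable_straddle (R : realType) n (x : R -> 'cV[R]_n) t (e : R) :
  derivable x t 1 -> 0 < e -> exists2 d : R, 0 < d & forall s u,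
    s <= t -> t <= u -> u - s < d ->
    `|x u - x s - (u - s) *: derive1 x t| <= e * (u - s).
Proof.
move=> dx e0; rewrite derive1E.
have /cvgrPdist_lt/(_ e e0)[d /= d0 dP] := dx.
have hP h : `|h| < d -> `|x (h + t) - x t - h *: 'D_1 x t| <= e * `|h|.
  move=> hd; have [->|h0] := eqVneq h 0.
    by rewrite add0r scale0r !subrr !normr0 mulr0.
  have := dP h; rewrite /= sub0r normrN => /(_ hd h0)/ltW.
  rewrite [X in x (X + t)]mulr1 -/('D_1 x t).
  rewrite -(ler_pM2l (x := `|h|)) ?normr_gt0// -normrZ mulrC scalerBr scalerA.
  by rewrite mulfV// scale1r distrC.
exists d => // s u st tu us.
have h1 := hP (u - t); have h2 := hP (s - t).
rewrite !subrK in h1 h2.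
have ut0 : 0 <= u - t by rewrite subr_ge0.
have st0 : s - t <= 0 by rewrite subr_le0.
rewrite (ger0_norm ut0) in h1; rewrite (ler0_norm st0) in h2.
have -> : x u - x s - (u - s) *: 'D_1 x t =
  (x u - x t - (u - t) *: 'D_1 x t) - (x s - x t - (s - t) *: 'D_1 x t).
  have -> : (u - s) *: 'D_1 x t = (u - t) *: 'D_1 x t - (s - t) *: 'D_1 x t.
    by rewrite -scalerBl; congr (_ *: _); ring.
  move: ((u - t) *: _) ((s - t) *: _) => p q.
  by apply/matrixP => i j; rewrite !mxE; ring.
rewrite (le_trans (ler_normB _ _))//.
by have := h1; have := h2; lra.
Qed.

Section absolutely_continuous.
Context {R : realType} {n : nat} (x : R -> 'cV[R]_n).

Lemma absolutely_continuousS (a b a' b' : R) : a <= a' -> b' <= b ->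
  absolutely_continuous a b x -> absolutely_continuous a' b' x.
Proof.
move=> aa bb xab e e0; have [d d0 dP] := xab e e0.
exists d => // N s t st; apply: dP => i; have [h1 [h2 h3]] := st i.
by rewrite (le_trans aa)// h2 (le_trans h3).
Qed.

Lemma absolutely_continuous_dist (a b e : R) : absolutely_continuous a b x -> 0 < e ->
  exists2 d : R, 0 < d & forall s t, a <= s <= b -> a <= t <= b ->
    `|t - s| < d -> `|x t - x s| < e.
Proof.
move=> xab e0; have [d d0 dP] := xab e e0; exists d => //.
have le s t : a <= s -> s <= t -> t <= b -> t - s < d -> `|x t - x s| < e.
  move=> as_ st tb std; have := dP 1 (fun=> s) (fun=> t).
  rewrite !big_ord1; apply => //.
  by move=> i j; rewrite !ord1.
move=> s t /andP[as_ sb] /andP[at_ tb].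
have [st|/ltW ts] := leP s t.
  by rewrite ger0_norm ?subr_ge0//; exact: le.
by rewrite ler0_norm ?subr_le0// opprB => h; rewrite distrC; exact: le.
Qed.

End absolutely_continuous.

(** [V] is only locally Lipschitz, so [cousin] first cuts the time interval into pieces on which the
    curve stays in one Lipschitz ball; the almost everywhere criterion works on each piece. *)
Lemma decreases_along (R : realType) n (F : 'cV[R]_n -> set 'cV[R]_n)
    (D : set 'cV[R]_n) (V : 'cV[R]_n -> R) (x : R -> 'cV[R]_n) (a b c : R) :
  a <= b -> locally_lipschitz D V -> absolutely_continuous a b x ->
  (forall t, a <= t <= b -> D (x t)) ->
  (forall t, a <= t <= b -> decreases_at F V c (x t)) ->
  {ae @lebesgue_measure R, forall t, a < t -> t <= b ->
     derivable x t 1 /\ F (x t) (derive1 x t)} ->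
  V (x b) - V (x a) <= - c * (b - a).
Proof.
move=> ab VD xac Dx dx xF.
apply: (cousin (P := fun s u => V (x u) - V (x s) <= - c * (u - s))) => //.
  by move=> s t u _ _ _ _; lra.
move=> t0 t0ab; have [L [r r0 VL]] := locally_lipschitz_ball VD (Dx _ t0ab).
have [d d0 dP] := absolutely_continuous_dist xac r0.
have {t0ab}[at0 t0b] := andP t0ab.
exists d => // s u as_ st0 t0u ub us.
have su : s <= u by exact: le_trans t0u.
have near t : s <= t -> t <= u -> `|x t - x t0| < r.
  move=> st tu; apply: dP; rewrite ?at0 ?t0b ?(le_trans as_) ?(le_trans tu)//.
  by rewrite ltr_norml; apply/andP; split; lra.
apply: (absolutely_continuous_decrease (phi := V \o x) (L := L) su).
- exact: absolutely_continuousS xac.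
- move=> p q sp pq qu /=; apply: VL; apply: near => //.
    exact: le_trans pq.
  exact: le_trans qu.
apply: (@filterS _ _ (ae_filter_ringOfSetsType _)) xF => t xt st tu e e0.
have {xt}[dxt Fxt] := xt (le_lt_trans as_ st) (le_trans tu ub).
have [f f0 fP] : decreases_at F V c (x t).
  by apply: dx; rewrite (le_trans as_ (ltW st)) (le_trans tu ub).
have f2 : 0 < f / 2 by rewrite divr_gt0.
have [g g0 gP] := derivable_straddle dxt f2.
have [h h0 hP] := absolutely_continuous_dist xac f0.
exists (Num.min g (Num.min h f)); first by rewrite !lt_min g0 h0.
move=> p q sp pt tq qu; rewrite !lt_min => /and3P[pqg pqh pqf].
have [->|pq] := eqVneq p q; first by rewrite !subrr !mulr0.
have {}pq : 0 < q - p by rewrite subr_gt0 lt_neqAle pq (le_trans pt).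
have ap := le_trans as_ sp; have qb := le_trans qu ub.
(* The mean velocity reaches [x q] from [x p] exactly, and it is close to the derivative at [t]: it
   is the perturbed direction that [decreases_at] allows. *)
pose w := (q - p)^-1 *: (x q - x p).
have xq : x q = x p + (q - p) *: w.
  by rewrite scalerA mulfV ?gt_eqF// scale1r subrKC.
rewrite /= {1}xq mulrDl; apply: (@le_trans _ _ (- c * (q - p))); last first.
  by rewrite lerDl mulr_ge0// ltW.
apply: (fP _ (derive1 x t)) => //; last by rewrite pq.
- rewrite distrC; apply: hP.
  + by rewrite ap (le_trans pt)// (le_trans tq).
  + by rewrite (le_trans ap)//= (le_trans tq).
  + by rewrite ger0_norm ?subr_ge0//; lra.
- have := gP p q pt tq pqg.
  have -> : x q - x p - (q - p) *: derive1 x t = (q - p) *: (w - derive1 x t).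
    by rewrite scalerBr scalerA mulfV ?gt_eqF// scale1r.
  rewrite normrZ gtr0_norm// mulrC ler_pM2r// => /le_lt_trans; apply; lra.
Qed.

(** * Behaviour of V along solutions *)

Lemma last_below (R : realType) (phi : R -> R) (a b c : R) : a <= b ->
  (forall t, a <= t <= b -> forall e : R, 0 < e -> exists2 d : R, 0 < d &
     forall s, a <= s <= b -> `|s - t| < d -> `|phi s - phi t| < e) ->
  phi a <= c -> c < phi b ->
  exists p, [/\ a <= p < b, phi p = c & forall t, p < t <= b -> c < phi t].
Proof.
move=> ab phic pa pb; pose S := [set t | a <= t <= b /\ phi t <= c].
have Sa : S a by split; rewrite ?lexx.
have supS : has_sup S by split; [exists a|exists b => t [/andP[]]].
pose p := sup S.
have ap : a <= p by apply: ub_le_sup => //; exact: supS.2.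
have pb' : p <= b by apply: ge_sup => [|t [/andP[]]//]; exists a.
have gtp t : p < t <= b -> c < phi t.
  move=> /andP[pt tb]; rewrite ltNge; apply/negP => tc.
  have : t <= p by apply: ub_le_sup;
    [exact: supS.2|rewrite /S /= tb (le_trans ap (ltW pt))].
  by rewrite leNgt pt.
have phip : phi p = c.
  apply/eqP; rewrite eq_le; apply/andP; split; apply/ler_addgt0Pl => e e0.
    have [d d0 dP] := phic p (introT andP (conj ap pb')) e e0.
    have [t St pt] := sup_adherent d0 supS; have [tab tc] := St.
    have tp : t <= p by apply: ub_le_sup => //; exact: supS.2.
    have : `|phi t - phi p| < e.
      by apply: dP => //; rewrite ler0_norm ?subr_le0//; move: pt; rewrite -/p; lra.
    by rewrite ltr_norml => /andP[h1 h2]; lra.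
  have [d d0 dP] := phic p (introT andP (conj ap pb')) e e0.
  have pltb : p < b.
    rewrite lt_neqAle pb' andbT; apply/negP => /eqP pbE.
    have := phic p; rewrite ap pb' => /(_ isT (phi b - c)).
    rewrite subr_gt0 => /(_ pb)[d' d'0 d'P].
    have [t' St' pt'] := sup_adherent d'0 supS.
    have [/andP[at'_ tb'] tc'] := St'.
    have tp' : t' <= p by apply: ub_le_sup => //; exact: supS.2.
    have : `|phi t' - phi p| < phi b - c.
      apply: d'P; rewrite ?at'_ ?tb'//.
      by rewrite ler0_norm ?subr_le0//; move: pt'; rewrite -/p; lra.
    by rewrite ltr_norml pbE => /andP[h1 h2]; lra.
  pose t := Num.min b (p + d / 2).
  have pt : p < t by rewrite lt_min pltb ltrDl divr_gt0.
  have tb : t <= b by rewrite ge_min lexx.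
  have td : t <= p + d / 2 by rewrite ge_min lexx orbT.
  have ct := gtp t (introT andP (conj pt tb)).
  have : `|phi t - phi p| < e.
    apply: dP; first by rewrite tb (le_trans ap (ltW pt)).
    by rewrite gtr0_norm ?subr_gt0//; lra.
  by rewrite ltr_norml => /andP[h1 h2]; lra.
exists p; split => //; rewrite ap lt_neqAle pb' andbT.
by apply/negP => /eqP pbE; move: pb; rewrite -pbE phip ltxx.
Qed.

Section lyapunov.
Context {R : realType} {n : nat} (X Xg : set 'cV[R]_n).
Context (F : 'cV[R]_n -> set 'cV[R]_n) (V : 'cV[R]_n -> R).
Context (X_closed : closed X) (X_bounded : bounded_set X) (X0 : X 0).
Context (Xg0 : Xg 0) (F_usc : upper_semicontinuous X F).
Context (F_compact : forall x, X x -> compact (F x)).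
Context (V_continuous : {within X, continuous V}).
Context (V_lipschitz : locally_lipschitz X° V).
Context (V_pos : forall x, X x -> x != 0 -> 0 < V x) (V_0 : V 0 = 0).
Context (V_boundary : forall x, boundary X x -> 1 <= V x).
Context (V_decr : forall x, X° x -> ~ Xg x ->
  forall q, time_derivative F V x q -> q + (1 - V x) ^+ 2 <= 0).
Context (V_decr_g : forall x, X° x -> Xg x -> x != 0 ->
  forall q, time_derivative F V x q -> q < 0).

Lemma V_ge0 y : X y -> 0 <= V y.
Proof. by move=> Xy; have [->|/(V_pos Xy)/ltW//] := eqVneq y 0; rewrite V_0. Qed.

Lemma sublevel_interior y : X y -> V y < 1 -> X° y.
Proof.
move=> Xy Vy; apply: contrapT => nXy; move: Vy; rewrite ltNge => /negP; apply.
by apply: V_boundary; split => //; exact: subset_closure.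
Qed.

Lemma sublevel_decreases_out y c : X y -> V y < 1 -> ~ Xg y ->
  c < (1 - V y) ^+ 2 -> decreases_at F V c y.
Proof.
move=> Xy Vy Xgy cV; have Xoy := sublevel_interior Xy Vy.
have [|e e0] := time_derivative_decreases (k := - c) V_lipschitz Xoy (F_compact Xy).
  by move=> q /(V_decr Xoy Xgy); lra.
by rewrite opprK; apply: decreases_at_le; rewrite lerDr ltW.
Qed.

Lemma sublevel_decreases y : X y -> V y < 1 -> y != 0 ->
  exists2 c, 0 < c & decreases_at F V c y.
Proof.
move=> Xy Vy y0; have Xoy := sublevel_interior Xy Vy.
have [|e e0] := time_derivative_decreases (k := 0) V_lipschitz Xoy (F_compact Xy).
  move=> q qy; have [Xgy|Xgy] := pselect (Xg y); first exact: V_decr_g qy.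
  have := V_decr Xoy Xgy qy; have : 0 < (1 - V y) ^+ 2 by rewrite exprn_gt0// subr_gt0.
  lra.
by rewrite subr0; exists e.
Qed.

Section trajectory.
Context (T : \bar R) (x : R -> 'cV[R]_n) (x_sol : solution X F T x).

Let lt_time (s t : R) : s <= t -> (t%:E < T)%E -> (s%:E < T)%E.
Proof. by move=> st; apply: le_lt_trans; rewrite lee_fin. Qed.

Lemma solution_dist (b : R) : 0 <= b -> (b%:E < T)%E ->
  forall t, 0 <= t <= b -> forall e : R, 0 < e -> exists2 d : R, 0 < d &
    forall s, 0 <= s <= b -> `|s - t| < d -> `|V (x s) - V (x t)| < e.
Proof.
move=> b0 bT t t0b e e0; have [_ Xx xac _] := x_sol.
have inX s : 0 <= s <= b -> X (x s).
  by move=> /andP[s0 sb]; apply: Xx => //; exact: lt_time bT.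
have [d d0 dP] := within_continuous_dist V_continuous (inX t t0b) e0.
have [f f0 fP] := absolutely_continuous_dist (xac b b0 bT) d0.
by exists f => // s sb st; apply: dP; [exact: inX|exact: fP].
Qed.

Lemma trajectory_decreases (a b c : R) : 0 <= a -> a <= b -> (b%:E < T)%E ->
  (forall t, a <= t <= b -> V (x t) < 1) ->
  (forall t, a <= t <= b -> decreases_at F V c (x t)) ->
  V (x b) - V (x a) <= - c * (b - a).
Proof.
move=> a0 ab bT V1 xdec; have [_ Xx xac xF] := x_sol.
apply: (decreases_along ab V_lipschitz _ _ xdec).
- apply: absolutely_continuousS (xac b (le_trans a0 ab) bT) => //.
- move=> t tab; have /andP[at_ tb] := tab; apply: sublevel_interior (V1 t tab).
  by apply: Xx; [exact: le_trans at_|exact: lt_time bT].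
- apply: (@filterS _ _ (ae_filter_ringOfSetsType _)) xF => t xt at_ tb.
  by apply: xt; [exact: le_lt_trans at_|exact: lt_time bT].
Qed.

(** If [V] rose, it would leave some level [c] for the last time at [p]. Just after [p] it lies
    between [c] and 1, where it cannot increase, yet it exceeds [c] there. *)
Lemma trajectory_nonincreasing (s t : R) : 0 <= s -> s <= t -> (t%:E < T)%E ->
  V (x s) < 1 -> V (x t) <= V (x s).
Proof.
move=> s0 st tT Vs; rewrite leNgt; apply/negP => Vst; have [_ Xx xac xF] := x_sol.
have inX u : s <= u <= t -> X (x u).
  by move=> /andP[su ut]; apply: Xx; [exact: le_trans su|exact: lt_time tT].
have Vdist u : s <= u <= t -> forall e : R, 0 < e -> exists2 d : R, 0 < d &
    forall v, s <= v <= t -> `|v - u| < d -> `|V (x v) - V (x u)| < e.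
  move=> /andP[su ut] e e0.
  have [|d d0 dP] := solution_dist (le_trans s0 st) tT (t := u) _ e0.
    by rewrite ut (le_trans s0).
  by exists d => // v /andP[sv vt]; apply: dP; rewrite vt (le_trans s0).
(* Being positive, the level keeps the curve away from 0; being below 1, it leaves room for a short
   time in the region where decrease is known. *)
pose c := (V (x s) + Num.min 1 (V (x t))) / 2.
have hmin : V (x s) < Num.min 1 (V (x t)) by rewrite lt_min Vs.
have [cs c1 ct] : [/\ V (x s) < c, c < 1 & c < V (x t)].
  have h1 : Num.min 1 (V (x t)) <= 1 by rewrite ge_min lexx.
  have h2 : Num.min 1 (V (x t)) <= V (x t) by rewrite ge_min lexx orbT.
  by rewrite /c; split; lra.
have c0 : 0 < c by apply: le_lt_trans cs; apply: V_ge0; apply: inX; rewrite lexx.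
have [p [/andP[sp pt] Vp Vgt]] := last_below (phi := V \o x) st Vdist (ltW cs) ct.
have c10 : 0 < 1 - c by rewrite subr_gt0.
have [|d d0 dP] := Vdist p _ _ c10; first by rewrite sp ltW.
pose q := Num.min t (p + d / 2).
have pq : p < q by rewrite lt_min pt ltrDl divr_gt0.
have qt : q <= t by rewrite ge_min lexx.
have qd : q <= p + d / 2 by rewrite ge_min lexx orbT.
have pqV u : p <= u <= q -> c <= V (x u) /\ V (x u) < 1.
  move=> /andP[pu uq]; have ut := le_trans uq qt; have su := le_trans sp pu.
  split.
    move: pu; rewrite le_eqVlt => /predU1P[<-|pu]; first by rewrite -Vp.
    by apply: ltW; apply: Vgt; rewrite pu.
  have : `|V (x u) - V (x p)| < 1 - c.
    by apply: dP; rewrite ?su// ger0_norm ?subr_ge0//; lra.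
  by rewrite ltr_norml /= in Vp * => /andP[h1 h2]; move: Vp => /= Vp; lra.
(* The rates of decrease depend on the point, so they are weakened to the common rate 0. *)
have := @trajectory_decreases p q 0 (le_trans s0 sp) (ltW pq) (lt_time qt tT).
rewrite oppr0 mul0r => H; have {H} : V (x q) - V (x p) <= 0.
  apply: H => u upq; have [cu u1] := pqV u upq => //.
  have /andP[pu uq] := upq.
  have [||e e0] := sublevel_decreases (y := x u) _ u1.
  - by apply: inX; rewrite (le_trans sp)// (le_trans uq).
  - by apply: contraTneq cu => ->; rewrite V_0 -ltNge.
  by apply: decreases_at_le; exact: ltW.
have : c < V (x q) by apply: Vgt; rewrite pq.
by move: Vp => /= ->; lra.
Qed.

Lemma trajectory_sublevel (t : R) : V (x 0) < 1 -> 0 <= t -> (t%:E < T)%E ->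
  V (x t) < 1.
Proof.
move=> V01 t0 tT.
by rewrite (le_lt_trans _ V01)// trajectory_nonincreasing.
Qed.

Lemma trajectory_reaches : V (x 0) < 1 ->
  ((V (x 0) / (1 - V (x 0)))%:E < T)%E ->
  exists t, [/\ 0 <= t, t <= V (x 0) / (1 - V (x 0)) & Xg (x t)].
Proof.
move=> V01; set tau := V (x 0) / _ => tauT; apply: contrapT => nXg.
have [T0 Xx _ _] := x_sol.
have tau0 : 0 <= tau.
  by rewrite divr_ge0 ?subr_ge0 ?(ltW V01)//; apply: V_ge0; exact: Xx.
have tT t : t <= tau -> (t%:E < T)%E by move=> h; exact: lt_time tauT.
have Xt t : 0 <= t <= tau -> X (x t) by move=> /andP[t0 ttau]; apply: Xx => //; exact: tT.
have Xgt t : 0 <= t <= tau -> ~ Xg (x t).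
  by move=> /andP[t0 ttau] Xgt; apply: nXg; exists t.
have Vt t : 0 <= t <= tau -> V (x t) < 1.
  by move=> /andP[t0 ttau]; apply: trajectory_sublevel => //; exact: tT.
(* chi decreases at unit speed as long as x stays out of Xg. *)
pose chi t := (1 - V (x t))^-1.
have chile : chi tau - chi 0 <= - 1 * (tau - 0).
  apply/ler_addgt0Pr => e0 e00.
  pose e := Num.min (1 / 2) (e0 / (tau + 1)).
  have tau1 : 0 < tau + 1 by rewrite ltr_wpDl.
  have e_gt0 : 0 < e by rewrite lt_min !divr_gt0.
  have e1 : e <= 1 / 2 by rewrite ge_min lexx.
  have e2 : e * (tau + 1) <= e0 by rewrite -ler_pdivlMr// ge_min lexx orbT.
  suff : chi tau - chi 0 <= - (1 - e) * (tau - 0).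
    by move=> h; apply: le_trans h _; move: e2; lra.
  (* The rate of [V] varies along the curve. On short intervals it is nearly constant, and the loss
     is the factor [1 - e]. *)
  apply: (cousin (P := fun s u => chi u - chi s <= - (1 - e) * (u - s))) => //.
    by move=> s t u _ _ _ _; lra.
  move=> t t0tau; pose m := 1 - V (x t).
  have m0 : 0 < m by rewrite subr_gt0 Vt.
  (* With [1 - V] within a relative error [e / 4] of [m], the comparison needed is [(1 - e) * (1 + e
     / 4) <= (1 - e / 2) * (1 - e / 4)]. *)
  have em0 : 0 < m * e / 4 by rewrite divr_gt0// mulr_gt0.
  have [d d0 dP] := solution_dist tau0 tauT t0tau em0.
  exists d => // s u s0 st tu utau us; have su := le_trans st tu.
  have {t0tau}[t0 ttau] := andP t0tau.
  have stau : s <= tau by rewrite (le_trans su).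
  have u0 : 0 <= u by rewrite (le_trans s0).
  have /ltr_normlP[hs1 hs2] : `|V (x s) - V (x t)| < m * e / 4.
    by apply: dP; rewrite ?s0 ?stau// ltr_norml; apply/andP; split; lra.
  have /ltr_normlP[hu1 hu2] : `|V (x u) - V (x t)| < m * e / 4.
    by apply: dP; rewrite ?u0 ?utau// ltr_norml; apply/andP; split; lra.
  have Vs := Vt s (introT andP (conj s0 stau)).
  have Vu := Vt u (introT andP (conj u0 utau)).
  set a := 1 - V (x s); set b := 1 - V (x u).
  have a0 : 0 < a by rewrite subr_gt0.
  have b0 : 0 < b by rewrite subr_gt0.
  have key : (1 - e) * b <= (1 - e / 2) * a.
    have ha : m - m * e / 4 <= a by rewrite /a /m; move: hs1 hs2; rewrite /m; lra.
    have hb : b <= m + m * e / 4 by rewrite /b /m; move: hu1 hu2; rewrite /m; lra.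
    apply: (@le_trans _ _ ((1 - e) * (m + m * e / 4))).
      by rewrite ler_wpM2l//; lra.
    apply: (@le_trans _ _ ((1 - e / 2) * (m - m * e / 4))); last first.
      by rewrite ler_wpM2l//; lra.
    nra.
  (* By monotonicity [1 - V] is at least [a] from time [s] on. The factor [1 - e / 2] gives the
     strict inequality that [sublevel_decreases_out] asks for. *)
  have : V (x u) - V (x s) <= - ((1 - e / 2) * a ^+ 2) * (u - s).
    apply: trajectory_decreases => //; first exact: tT.
      move=> v /andP[sv vu]; apply: Vt.
      by rewrite (le_trans s0)// (le_trans vu).
    move=> v /andP[sv vu].
    have v0t : 0 <= v <= tau by rewrite (le_trans s0)// (le_trans vu).
    apply: sublevel_decreases_out; [exact: Xt|exact: Vt|exact: Xgt|].
    have va : a <= 1 - V (x v).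
      by rewrite lerD2l lerN2 trajectory_nonincreasing// tT// (le_trans vu).
    apply: (@lt_le_trans _ _ (a ^+ 2)).
      by rewrite gtr_pMl ?exprn_gt0//; lra.
    by rewrite lerXn2r// nnegrE ltW// (lt_le_trans a0).
  have -> : V (x u) - V (x s) = a - b by rewrite /a /b; ring.
  rewrite /chi -/a -/b => h.
  have -> : b^-1 - a^-1 = (a - b) / (a * b).
    by field; rewrite !gt_eqF.
  rewrite ler_pdivrMr ?mulr_gt0//; apply: le_trans h _.
  rewrite !mulNr lerN2 -subr_ge0.
  have -> : (1 - e / 2) * a ^+ 2 * (u - s) - (1 - e) * (u - s) * (a * b) =
     (u - s) * a * ((1 - e / 2) * a - (1 - e) * b) by ring.
  by rewrite mulr_ge0 ?subr_ge0// mulr_ge0 ?subr_ge0// ltW.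
have tautau : 0 <= tau <= tau by rewrite tau0 lexx.
(* As [chi 0] is [tau + 1], unit speed yields [chi tau <= 1], that is [V (x tau) <= 0]. This is
   impossible outside [Xg], which contains 0. *)
have xtau0 : x tau != 0 by apply/eqP => h; apply: (Xgt _ tautau); rewrite h.
have Vtau := V_pos (Xt _ tautau) xtau0.
have Vtau1 := Vt _ tautau.
have chi1 : 1 < chi tau.
  by rewrite /chi invf_gt1 ?subr_gt0// gtrBl.
have chi0 : chi 0 = tau + 1.
  by rewrite /chi /tau; field; rewrite gt_eqF// subr_gt0.
move: chile; rewrite chi0; lra.
Qed.

End trajectory.

(** [m] is the minimum of [V] on the compact part of [X] at distance at least [e] from 0, or 1 if
    that part is empty. *)
Lemma sublevel_norm (e : R) : 0 < e -> exists2 m : R, 0 < m &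
  forall y, X y -> V y < m -> `|y| < e.
Proof.
move=> e0; pose K := X `&` [set y | e <= `|y|].
have cK : compact K.
  apply: cV_bounded_closed_compact.
    by have [M [Mr XM]] := X_bounded; exists M; split => // r /XM rX y [/rX].
  apply: closedI => //; exact: (closed_comp
    (fun y _ => @norm_continuous _ _ y) (@closed_ge _ e)).
have [[y Ky]|K0] := pselect (K !=set0); last first.
  exists 1 => // y Xy _; rewrite ltNge; apply/negP => ey.
  by apply: K0; exists y.
have [z /set_mem[Xz /= ez] zmin] := compact_EVT_min (ex_intro _ y Ky) cK
  (continuous_subspaceW (@subIsetl _ _ _) V_continuous).
exists (V z).
  by apply: V_pos => //; rewrite -normr_gt0 (lt_le_trans e0).
move=> w Xw; apply: contraTT; rewrite -!leNgt => ew; apply: zmin.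
by rewrite inE; split.
Qed.

Lemma sublevel_stable (T : \bar R) x (e : R) : 0 < e -> exists2 m : R,
  0 < m <= 1 & (solution X F T x -> forall s t, 0 <= s -> s <= t ->
    (t%:E < T)%E -> V (x s) < m -> `|x t| < e).
Proof.
move=> e0; have [m m0 mP] := sublevel_norm e0.
exists (Num.min m 1); first by rewrite lt_min m0 ltr01 ge_min lexx orbT.
move=> xsol s t s0 st tT; rewrite lt_min => /andP[Vsm Vs1]; apply: mP.
  by have [_ Xx _ _] := xsol; apply: Xx => //; exact: le_trans st.
exact: le_lt_trans (trajectory_nonincreasing xsol s0 st tT Vs1) Vsm.
Qed.

(** The band avoids both the origin and the boundary of [X]. Compactness is applied to all of [X]:
    near a point off the band the claim is vacuous, by continuity of [V]. *)
Lemma sublevel_uniform_decrease (m M : R) : 0 < m -> M < 1 ->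
  exists2 c : R, 0 < c & forall y, X y -> m <= V y <= M -> decreases_at F V c y.
Proof.
move=> m0 M1; have [c c0 cP] : exists2 c : R, 0 < c &
    forall y, X y -> X y -> m <= V y <= M -> decreases_at F V c y.
  apply: (compact_uniform (cV_bounded_closed_compact X_bounded X_closed)).
  move=> y Xy; have [mV|Vm] := leP m (V y); last first.
    have [|d d0 dP] := within_continuous_dist V_continuous Xy (e := m - V y).
      by rewrite subr_gt0.
    exists d => // z e zy _ Xz /andP[mz _]; exfalso.
    by have := dP z Xz zy; rewrite ltr_norml => /andP[_]; lra.
  have [VM|MV] := leP (V y) M; last first.
    have [|d d0 dP] := within_continuous_dist V_continuous Xy (e := V y - M).
      by rewrite subr_gt0.
    exists d => // z e zy _ Xz /andP[_ zM]; exfalso.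
    by have := dP z Xz zy; rewrite ltr_norml => /andP[+ _]; lra.
  have y0 : y != 0 by apply: contraTneq mV => ->; rewrite V_0 -ltNge.
  have [c c0 Dc] := sublevel_decreases Xy (le_lt_trans VM M1) y0.
  have [d d0 dP] := decreases_at_near F_usc Xy Dc.
  exists (Num.min c d); first by rewrite lt_min c0.
  move=> z e; rewrite lt_min => /andP[_ zd] /andP[_ ]; rewrite lt_min.
  move=> /andP[ec _] Xz _; apply: decreases_at_le (ltW ec) _; exact: dP.
by exists c => // y Xy; exact: cP.
Qed.

Lemma trajectory_cvg0 x : solution X F +oo x -> V (x 0) < 1 ->
  x t @[t --> +oo] --> (0 : 'cV[R]_n).
Proof.
move=> xsol V01; have [_ Xx _ _] := xsol.
have ltoo (t : R) : (t%:E < +oo)%E by rewrite ltry.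
apply/cvgrPdist_lt => e e0.
have [m /andP[m0 m1] mP] := sublevel_stable +oo x e0.
suff [s s0 Vs] : exists2 s : R, 0 <= s & V (x s) < m.
  exists s; split; first exact: num_real.
  by move=> t st; rewrite /= sub0r normrN; apply: (mP xsol s t s0 (ltW st)).
apply: contrapT => Vm.
have {}Vm s : 0 <= s -> m <= V (x s).
  by move=> s0; rewrite leNgt; apply/negP => h; apply: Vm; exists s.
have [c c0 cP] := sublevel_uniform_decrease m0 V01.
(* By this time the uniform rate would have brought [V] down to 0, below [m]. *)
pose t := V (x 0) / c.
have t0 : 0 <= t by rewrite divr_ge0 ?(ltW c0)//; apply: V_ge0; exact: Xx.
have : V (x t) - V (x 0) <= - c * (t - 0).
  apply: (trajectory_decreases xsol) => // s /andP[s0 st].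
    exact: (trajectory_sublevel xsol).
  apply: cP; first exact: Xx.
  by rewrite Vm//= (trajectory_nonincreasing xsol).
have ct : c * t = V (x 0) by rewrite mulrC mulfVK ?gt_eqF.
by have := Vm t t0; rewrite subr0 mulNr ct; lra.
Qed.

End lyapunov.

(** * Existence and continuation of solutions *)

(** A cluster point of an ultrafilter is a limit. One ultrafilter serves all times at once, which
    replaces a diagonal extraction. *)
Lemma compact_ultrafilter_limit (T : topologicalType) (I : Type)
    (U : set_system I) (u : I -> T) (K : set T) : UltraFilter U -> compact K ->
  (forall i, K (u i)) -> exists p : T, fmap u U --> p.
Proof.
move=> UU cK Ku; have PU : ProperFilter U by exact: ultra_proper.
have [|p [_ pcl]] := cK (fmap u U) (fmap_proper_filter u PU).
  suff : U (u @^-1` K) by [].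
  by apply: filterS filterT => i _; exact: Ku.
exists p => B pB; have [//|] := in_ultra_setVsetC (u @^-1` B) UU.
by move=> nB; have [y []] := pcl (~` B) B nB pB.
Qed.

(** * Euler polygons and their limits *)

Section euler.
Context {R : realType} {n : nat} (f : 'cV[R]_n -> 'cV[R]_n) (x0 : 'cV[R]_n).
Context (M : R) (fM : forall y, `|f y| <= M).

Let eta (k : nat) : R := k.+1%:R^-1.
Let eta_gt0 k : 0 < eta k. Proof. by rewrite invr_gt0. Qed.
Let M0 : 0 <= M. Proof. exact: le_trans (normr_ge0 _) (fM 0). Qed.

Definition euler_node (k j : nat) : 'cV[R]_n :=
  iter j (fun y => y + eta k *: f y) x0.

Definition euler_index (k : nat) (t : R) : nat := Num.truncn (t * k.+1%:R).

(** Piecewise constant instead of piecewise linear: the difference is at most [M * eta k], which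
    vanishes in the limit. *)
Definition euler_step (k : nat) (t : R) : 'cV[R]_n :=
  euler_node k (euler_index k t).

Lemma euler_index_le k s t : s <= t -> (euler_index k s <= euler_index k t)%N.
Proof. by move=> st; apply: le_truncn; rewrite ler_wpM2r. Qed.

Lemma euler_index_dist k s t : 0 <= s -> 0 <= t ->
  `|eta k * ((euler_index k t)%:R - (euler_index k s)%:R) - (t - s)| <= eta k.
Proof.
move=> s0 t0.
have /andP[s1 s2] := truncn_itv (mulr_ge0 s0 (ler0n R k.+1)).
have /andP[t1 t2] := truncn_itv (mulr_ge0 t0 (ler0n R k.+1)).
rewrite -!/(euler_index _ _) in s1 s2 t1 t2.
have -> : t - s = eta k * (t * k.+1%:R - s * k.+1%:R).
  by rewrite -mulrBl mulrCA mulVf ?mulr1// pnatr_eq0.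
rewrite -mulrBr normrM gtr0_norm// ler_piMr ?(ltW (eta_gt0 k))//.
by rewrite ler_norml -!natr1 in s2 t2 *; apply/andP; split; lra.
Qed.

Lemma euler_node_dist k i j :
  `|euler_node k (i + j) - euler_node k i| <= eta k * M * j%:R.
Proof.
elim: j => [|j IH]; first by rewrite addn0 subrr normr0 mulr0.
rewrite addnS /= addrAC (le_trans (ler_normD _ _))// -natr1 mulrDr mulr1 lerD//.
by rewrite normrZ gtr0_norm// ler_wpM2l// (ltW (eta_gt0 k)).
Qed.

Lemma euler_node_dot k i j g q :
  (forall l, (l < j)%N -> dot g (f (euler_node k (i + l))) <= q) ->
  dot g (euler_node k (i + j) - euler_node k i) <= eta k * q * j%:R.
Proof.
elim: j => [|j IH] h; first by rewrite addn0 subrr dot0r mulr0.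
rewrite addnS /= addrAC dotDr dotZr -natr1 mulrDr mulr1 lerD//.
  by apply: IH => l lj; apply: h; exact: leqW.
by rewrite ler_wpM2l ?(ltW (eta_gt0 k))// h.
Qed.

Lemma euler_step_dist k s t : 0 <= s -> s <= t ->
  `|euler_step k t - euler_step k s| <= M * (t - s + eta k).
Proof.
move=> s0 st; have ij := euler_index_le k st.
have := euler_node_dist k (euler_index k s) (euler_index k t - euler_index k s).
rewrite subnKC// => /le_trans; apply.
rewrite mulrAC mulrC ler_wpM2l//.
have := euler_index_dist k s0 (le_trans s0 st); rewrite -natrB//.
by rewrite ler_norml => /andP[_]; lra.
Qed.

Lemma euler_step0 k : euler_step k 0 = x0.
Proof. by rewrite /euler_step /euler_index mul0r truncn0. Qed.

Context (U : set_system nat) (UU : UltraFilter U) (oU : \oo `<=` U).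

Let PU : ProperFilter U. Proof. exact: ultra_proper. Qed.

Lemma euler_limit_ex t : exists p : 'cV[R]_n, 0 <= t ->
  euler_step k t @[k --> U] --> (p : 'cV[R]_n).
Proof.
have [t0|t0] := leP 0 t; last by exists 0.
pose K : set 'cV[R]_n := closed_ball_ Num.norm x0 (M * (t + 1)).
have [||p] := @compact_ultrafilter_limit _ _ U (euler_step ^~ t) K UU.
- apply: cV_bounded_closed_compact.
    exists (M * (t + 1) + `|x0|); split; first exact: num_real.
    move=> r Mr y /= yK; apply: le_trans (ltW Mr).
    by rewrite -[y in `|y|](subrK x0) (le_trans (ler_normD _ _))// lerD2r distrC.
  exact: closed_closed_ball_.
- move=> k; have := euler_step_dist k (lexx 0) t0.
  rewrite euler_step0 subr0 /K /closed_ball_ /= distrC.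
  move=> /le_trans; apply; rewrite ler_wpM2l// lerD2l.
  by rewrite invf_le1 ?ler1n.
- by exists p.
Qed.

(* A pointwise limit along the ultrafilter U stands in for a uniform limit of a
   subsequence. *)
Definition euler_limit t : 'cV[R]_n := sval (cid (euler_limit_ex (Num.max 0 t))).

Lemma euler_limit_near t e : 0 <= t -> 0 < e ->
  U [set k | `|euler_limit t - euler_step k t| < e].
Proof.
move=> t0 e0; rewrite /euler_limit; case: cid => p /=.
rewrite (max_idPr t0) => /(_ t0) /cvgrPdist_lt/(_ e e0).
exact.
Qed.

Lemma euler_eta_near e : 0 < e -> U [set k | eta k < e].
Proof.
by move=> e0; apply: oU; exact: (near_infty_natSinv_lt (PosNum e0)).
Qed.

Lemma euler_limit0 : euler_limit 0 = x0.
Proof.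
apply/eqP; rewrite -subr_eq0 -normr_le0; apply/ler_addgt0Pr => e e0.
have [k /= ke] := filter_ex (euler_limit_near (lexx 0) e0).
move: ke; rewrite euler_step0 add0r.
exact: ltW.
Qed.

(** The mesh error [M * eta k] disappears along [U]. Clamping negative times to 0 extends the bound
    to the whole line, as required for almost everywhere derivability. *)
Lemma euler_limit_lipschitz s t :
  `|euler_limit t - euler_limit s| <= M * `|t - s|.
Proof.
have le0 a b : 0 <= a -> a <= b ->
    `|euler_limit b - euler_limit a| <= M * (b - a).
  move=> a0 ab; apply/ler_addgt0Pr => e0 e00.
  have b0 := le_trans a0 ab.
  pose e := e0 / (M + 2).
  have M2 : 0 < M + 2 by rewrite ltr_wpDl.
  have e_gt0 : 0 < e by rewrite divr_gt0.
  have eE : e0 = e * (M + 2) by rewrite mulfVK// gt_eqF.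
  have [k [[/= ka kb] ke]] := filter_ex (filterI (filterI
    (euler_limit_near a0 e_gt0) (euler_limit_near b0 e_gt0))
    (euler_eta_near e_gt0)).
  have h1 := euler_step_dist k a0 ab.
  have h2 := ler_distD (euler_step k b) (euler_limit b) (euler_limit a).
  have h3 := ler_distD (euler_step k a) (euler_step k b) (euler_limit a).
  rewrite (distrC (euler_step k a)) in h3.
  have : M * eta k <= M * e by rewrite ler_wpM2l// ltW.
  rewrite eE; move: h1 h2 h3 ka kb; rewrite mulrDr; lra.
have mE u : euler_limit u = euler_limit (Num.max 0 u).
  by rewrite /euler_limit; congr (sval (cid (euler_limit_ex _))); rewrite maxA maxxx.
wlog st : s t / s <= t => [h|].
  have [|/ltW ts] := leP s t; first exact: h.
  by rewrite distrC (distrC t); exact: h.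
rewrite (mE t) (mE s); apply: le_trans (le0 _ _ _ _) _.
- by rewrite le_max lexx.
- by rewrite ge_max !le_max lexx st orbT.
- rewrite ler_wpM2l// ger0_norm ?subr_ge0//.
  by rewrite !maxEle; case: ifP; case: ifP; lra.
Qed.

(** [f] may be discontinuous, so its values do not pass to the limit, but half-space bounds on its
    sums do. The nodes visited stay within [rho]: one quarter each for the distance to the limit,
    the motion and the mesh. *)
Lemma euler_limit_dot t u g q rho : 0 <= t -> t <= u -> 0 < rho ->
  M * (u - t) <= rho / 4 ->
  (forall y, `|y - euler_limit t| < rho -> dot g (f y) <= q) ->
  dot g (euler_limit u - euler_limit t) <= q * (u - t).
Proof.
move=> t0 tu rho0 Mut fq; apply/ler_addgt0Pr => e0 e00.
have u0 := le_trans t0 tu.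
pose K := \sum_i `|g i 0|.
have K0 : 0 <= K by apply: sumr_ge0.
(* [K * e] is lost at each of the two ends, and [|q| * e] in replacing the time covered by whole
   steps by [u - t]. *)
pose e := e0 / (K + K + `|q| + 1).
have D0 : 0 < K + K + `|q| + 1 by rewrite ltr_wpDl// !addr_ge0.
have e_gt0 : 0 < e by rewrite divr_gt0.
have eE : e * (K + K + `|q| + 1) = e0 by rewrite mulfVK// gt_eqF.
have r4 : 0 < rho / 4 by rewrite divr_gt0.
have rM : 0 < rho / 4 / (M + 1) by rewrite divr_gt0// ltr_wpDl.
have [k [[[/= kt ku] ke] [kr kM]]] := filter_ex (filterI (filterI (filterI
    (euler_limit_near t0 e_gt0) (euler_limit_near u0 e_gt0))
    (euler_eta_near e_gt0)) (filterI (euler_limit_near t0 r4) (euler_eta_near rM))).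
have ij := euler_index_le k tu.
set i := euler_index k t in ij; set j := euler_index k u in ij.
have idist := euler_index_dist k t0 u0.
rewrite -/i -/j -natrB// in idist.
have {}kM : M * eta k <= rho / 4.
  have : (M + 1) * eta k <= rho / 4.
    by rewrite mulrC -ler_pdivlMr ?ltW// ltr_wpDl.
  by have := eta_gt0 k; lra.
have node : dot g (euler_node k (i + (j - i)) - euler_node k i) <=
    eta k * q * (j - i)%:R.
  apply: euler_node_dot => l lj; apply: fq.
  have h1 := euler_node_dist k i l.
  have h2 : eta k * l%:R <= u - t + eta k.
    apply: (@le_trans _ _ (eta k * (j - i)%:R)).
      by rewrite ler_wpM2l ?(ltW (eta_gt0 k))// ler_nat ltnW.
    by move: idist; rewrite ler_norml => /andP[_]; lra.
  have h3 : eta k * M * l%:R <= M * (u - t) + M * eta k.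
    by rewrite mulrAC mulrC -mulrDr ler_wpM2l.
  have h4 := ler_distD (euler_node k i) (euler_node k (i + l)) (euler_limit t).
  have h5 : `|euler_node k i - euler_limit t| < rho / 4 by rewrite distrC.
  lra.
rewrite subnKC// in node.
have -> : euler_limit u - euler_limit t = (euler_step k u - euler_step k t) +
    ((euler_limit u - euler_step k u) - (euler_limit t - euler_step k t)).
  by apply/matrixP => a b; rewrite !mxE; ring.
rewrite dotDr [X in _ + X]dotBr.
have gu : dot g (euler_limit u - euler_step k u) <= K * e.
  rewrite (le_trans (ler_norm _))// (le_trans (norm_dot_le _ _))//.
  by rewrite ler_wpM2l// ltW.
have gt : - (K * e) <= dot g (euler_limit t - euler_step k t).
  rewrite lerNl (le_trans (ler_norm _))// normrN (le_trans (norm_dot_le _ _))//.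
  by rewrite ler_wpM2l// ltW.
have qe : eta k * q * (j - i)%:R <= q * (u - t) + `|q| * e.
  rewrite -lerBlDl (_ : _ - _ = q * (eta k * (j - i)%:R - (u - t))); last by ring.
  rewrite (le_trans (ler_norm _))// normrM ler_wpM2l//.
  by rewrite (le_trans idist)// ltW.
have {node qe} : dot g (euler_step k u - euler_step k t) <=
  q * (u - t) + `|q| * e := le_trans node qe.
move: gu gt; rewrite -eE !mulrDr mulr1 (mulrC e K) (mulrC e `|q|).
lra.
Qed.

End euler.

Lemma near_zero_multiple (R : realType) (K c : R) : 0 < c -> 0 <= K ->
  exists2 e : R, 0 < e & K * e < c.
Proof.
move=> c0 K0; exists (c / (K + 1)); first by rewrite divr_gt0// ltr_wpDl.
by rewrite mulrA ltr_pdivrMr ?ltr_wpDl// mulrC ltr_pM2l// ltrDl.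
Qed.

Lemma lipschitz_derivable_vector_ae (R : realType) n (y : R -> 'cV[R]_n) (M : R) :
  (forall s t, `|y t - y s| <= M * `|t - s|) ->
  {ae @lebesgue_measure R, forall t, derivable y t 1}.
Proof.
move=> yM; have h (i : 'I_n) :
    {ae @lebesgue_measure R, forall t, derivable (fun s => y s i 0) t 1}.
  apply: (@lipschitz_derivable_ae _ _ M) => s t.
  by apply: le_trans (yM s t); have := norm_coord (y t - y s) i; rewrite !mxE.
have : {ae @lebesgue_measure R, forall t i, derivable (fun s => y s i 0) t 1}.
  (* Null sets are gathered over the natural numbers, hence the recast of the ordinal index. *)
  suff H : {ae @lebesgue_measure R, forall t (k : nat) (kn : (k < n)%N),
      derivable (fun s => y s (Ordinal kn) 0) t 1}.
    apply: (@filterS _ _ (ae_filter_ringOfSetsType _)) H => t H i.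
    by have := H i (ltn_ord i); rewrite (_ : Ordinal _ = i)//; exact: val_inj.
  apply: ae_foralln => k; have [kn|nk] := pselect (k < n)%N; last by apply: aeW.
  apply: (@filterS _ _ (ae_filter_ringOfSetsType _)) (h (Ordinal kn)) => t H kn'.
  by rewrite (_ : Ordinal kn' = Ordinal kn)//; exact: val_inj.
apply: (@filterS _ _ (ae_filter_ringOfSetsType _)) => t H.
by apply/derivable_mxP => i j; rewrite ord1.
Qed.

Section existence.
Context {R : realType} {n : nat} (X : set 'cV[R]_n).
Context (F : 'cV[R]_n -> set 'cV[R]_n).
Context (F_usc : upper_semicontinuous X F).
Context (F_nonempty : forall x, X x -> F x !=set0).
Context (F_compact : forall x, X x -> compact (F x)).
Context (F_convex : forall x, X x -> convex_set (F x)).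

Lemma usc_bounded : closed X -> bounded_set X ->
  exists2 M : R, 0 <= M & forall x v, X x -> F x v -> `|v| <= M.
Proof.
move=> X_closed X_bounded.
(* The bound is sought as an inverse, so that it weakens as [e] decreases. Locally it comes from
   upper semicontinuity applied to a ball containing [F x]. *)
have [e e0 eP] : exists2 e : R, 0 < e &
    forall x, X x -> X x -> forall v, F x v -> `|v| <= e^-1.
  apply: (compact_uniform (cV_bounded_closed_compact X_bounded X_closed)) => x Xx.
  have [M [_ MF]] := compact_bounded (F_compact Xx).
  pose r := `|M| + 2; have r0 : 0 < r by rewrite ltr_wpDl.
  have FO : F x `<=` ball 0 r.
    move=> v Fv; rewrite -ball_normE /= sub0r normrN.
    rewrite (@le_lt_trans _ _ (`|M| + 1))//; last by rewrite ltrD2l ltr1n.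
    by apply: (MF _ _ v Fv); rewrite (le_lt_trans (ler_norm M))// ltrDl.
  have /nbhs_ballP[d /= d0 dF] := F_usc Xx (ball_open 0 r) FO.
  exists (Num.min d r^-1); first by rewrite lt_min d0 invr_gt0.
  move=> y e; rewrite !lt_min => /andP[yd _] /and3P[e0 _ er] Xy v Fv.
  have : ball 0 r v.
    by apply: (dF y) => //; rewrite -ball_normE /= distrC.
  rewrite -ball_normE /= sub0r normrN => /ltW /le_trans; apply.
  by rewrite -(invrK r) lef_pV2 ?posrE ?invr_gt0// ltW.
exists e^-1; first by rewrite invr_ge0 ltW.
by move=> x v Xx; exact: eP.
Qed.

(** Any selection of [F] drives the Euler scheme. If a derivative of the limit fell outside
    [F (y t)], a hyperplane would separate it from the values of [F] near [y t], hence from the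
    increments of the limit. *)
Lemma inclusion_exists (M : R) (x0 : 'cV[R]_n) :
  (forall x v, X x -> F x v -> `|v| <= M) -> X° x0 ->
  exists h : R, exists2 y : R -> 'cV[R]_n, 0 < h &
    [/\ y 0 = x0, forall s t, `|y t - y s| <= M * `|t - s|,
        forall t : R, 0 <= t -> t < h -> X (y t) &
        forall t : R, 0 < t -> t < h -> derivable y t 1 -> F (y t) (derive1 y t)].
Proof.
move=> FM Xx0; have M0 : 0 <= M.
  have [v Fv] := F_nonempty (interior_subset Xx0).
  by rewrite (le_trans (normr_ge0 v))// (FM x0)//; exact: interior_subset.
(* The default 0 keeps the selection bounded by [M] even at nodes outside [X]. *)
pose f z := xget 0 [set v | X z /\ F z v].
have fM z : `|f z| <= M.
  by rewrite /f; case: xgetP => [v _ [Xz Fv]|_]; [exact: FM Fv|rewrite normr0].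
have fF z : X z -> F z (f z).
  move=> Xz; rewrite /f; case: xgetP => [v _ []//|nF].
  by have [v Fv] := F_nonempty Xz; case: (nF v).
have [U [UU oU]] := @ultraFilterLemma _ \oo _.
pose y := euler_limit x0 fM UU.
have yM := euler_limit_lipschitz x0 fM UU oU.
have y0 : y 0 = x0 by exact: euler_limit0.
have /nbhs_ballP[r /= r0 rX] : nbhs x0 X by [].
pose h := r / (M + 1).
have M1 : 0 < M + 1 by rewrite ltr_wpDl.
have h0 : 0 < h by rewrite divr_gt0.
have yr t : 0 <= t -> t < h -> ball x0 r (y t).
  move=> t0 th; rewrite -ball_normE /= distrC -{1}y0.
  apply: le_lt_trans (yM 0 t) _; rewrite subr0 ger0_norm//.
  apply: (@le_lt_trans _ _ ((M + 1) * t)); first by rewrite ler_wpM2r// lerDl.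
  by rewrite mulrC -ltr_pdivlMr.
exists h, y => //; split => //.
  by move=> t t0 th; apply: rX; exact: yr.
move=> t t0 th dy; apply: contrapT => nF.
have Xyt : X (y t) by apply: rX; apply: yr => //; exact: ltW.
have [g [c c0 gc]] := compact_convex_separation (F_nonempty Xyt) (F_compact Xyt)
  (F_convex Xyt) nF.
set v := derive1 y t in gc *.
(* Half of the gap separates [F] on a whole neighbourhood; the other half exceeds the error of the
   derivative at [t]. *)
pose q := dot g v - c / 2.
have c2 : 0 < c / 2 by rewrite divr_gt0.
have oO : open [set w | dot g w < q].
  exact: (open_comp (fun w _ => @dot_continuous _ _ g w) (@open_lt _ q)).
have FO : F (y t) `<=` [set w | dot g w < q].
  by move=> w /gc /=; rewrite /q; lra.
have /nbhs_ballP[rho1 /= rho10 rho1F] := F_usc Xyt oO FO.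
have /nbhs_ballP[rho2 /= rho20 rho2X] : nbhs (y t) X.
  apply: filterS rX _; apply: open_nbhs_nbhs; split; first exact: ball_open.
  by apply: yr => //; exact: ltW.
pose rho := Num.min rho1 rho2.
have rho0 : 0 < rho by rewrite lt_min rho10.
have K0 : 0 <= \sum_i `|g i 0| by apply: sumr_ge0.
have [e e0 Ke] := near_zero_multiple c2 K0.
have [d d0 dP] := derivable_straddle dy e0.
have rho4 : 0 < rho / 4 by rewrite divr_gt0.
have [d' d'0 Md'] := near_zero_multiple rho4 M0.
pose u := t + Num.min (d / 2) d'.
have m0 : 0 < Num.min (d / 2) d' by rewrite lt_min divr_gt0.
have ut : u - t = Num.min (d / 2) d' by rewrite /u addrAC subrr add0r.
have tu : t <= u by rewrite -subr_ge0 ut ltW.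
have : dot g (y u - y t) <= q * (u - t).
  apply: (euler_limit_dot oU (ltW t0) tu rho0).
    rewrite ut (le_trans _ (ltW Md'))// ler_wpM2l// ge_min lexx orbT//.
  move=> z; rewrite lt_min => /andP[z1 z2]; apply: ltW.
  have Xz : X z by apply: rho2X; rewrite -ball_normE /= distrC.
  suff : F z `<=` [set w | dot g w < q] by apply; exact: fF.
  by apply: rho1F => //; rewrite -ball_normE /= distrC.
have := dP t u (lexx t) tu.
have utd : u - t < d.
  rewrite ut (le_lt_trans (y := d / 2))// ?ge_min ?lexx//.
  by rewrite ltr_pdivrMr// ltr_pMr// ltr1n.
move=> /(_ utd) dist.
have := norm_dot_le g (y u - y t - (u - t) *: derive1 y t).
have -> : dot g (y u - y t - (u - t) *: derive1 y t) =
    dot g (y u - y t) - (u - t) * dot g v by rewrite [LHS]dotBr dotZr.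
rewrite ler_norml => /andP[h1 _] h2.
have h3 : (\sum_i `|g i 0|) * `|y u - y t - (u - t) *: v| <=
    (\sum_i `|g i 0|) * (e * (u - t)) by rewrite ler_wpM2l.
have h4 : (\sum_i `|g i 0|) * (e * (u - t)) < c / 2 * (u - t).
  by rewrite mulrA ltr_pM2r// ut.
move: h2; rewrite /q mulrBl; move: h1 h3 h4; rewrite (mulrC (dot g v)).
lra.
Qed.

End existence.

Lemma derivable_shift (R : realType) n (y : R -> 'cV[R]_n) (c t : R) :
  derivable (fun s => y (s - c)) t 1 ->
  derivable y (t - c) 1 /\ derive1 y (t - c) = derive1 (fun s => y (s - c)) t.
Proof.
move=> dy; rewrite !derive1E /derive /derivable /=.
have E : (fun h : R => h^-1 *: (y (h *: 1 + (t - c)) - y (t - c))) =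
    (fun h : R => h^-1 *: (y (h *: 1 + t - c) - y (t - c))).
  by apply/funext => h; rewrite addrA.
by split; [rewrite /shift /= in dy *; rewrite E|rewrite /shift /= E].
Qed.

Lemma near_eq_derive1 (R : realType) n (f g : R -> 'cV[R]_n) (t : R) :
  (\forall s \near t, f s = g s) -> derivable f t 1 ->
  derivable g t 1 /\ derive1 g t = derive1 f t.
Proof.
move=> fg df; split; first exact: near_eq_derivable df.
by rewrite !derive1E; apply/esym; exact: near_eq_derive.
Qed.

Lemma lipschitz_absolutely_continuous (R : realType) n (x : R -> 'cV[R]_n)
    (a b M : R) : 0 <= M ->
  (forall s t, a <= s -> s <= t -> t <= b -> `|x t - x s| <= M * (t - s)) ->
  absolutely_continuous a b x.
Proof.
move=> M0 xM e e0; have [d d0 Md] := near_zero_multiple e0 M0.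
exists d => // N s t st _ std.
apply: (@le_lt_trans _ _ (M * \sum_(i < N) (t i - s i))).
  rewrite mulr_sumr; apply: ler_sum => i _; have [h1 [h2 h3]] := st i.
  exact: xM.
by apply: le_lt_trans Md; rewrite ler_wpM2l// ltW.
Qed.

(** * Continuation past a finite time *)

Section extension.
Context {R : realType} {n : nat} (X : set 'cV[R]_n).
Context (F : 'cV[R]_n -> set 'cV[R]_n).
Context (M : R) (M0 : 0 <= M) (FM : forall x v, X x -> F x v -> `|v| <= M).

Lemma solution_lipschitz T x : solution X F T x ->
  forall s t : R, 0 <= s -> s <= t -> (t%:E < T)%E -> `|x t - x s| <= M * (t - s).
Proof.
move=> [_ Xx xac xF] s t s0 st tT.
(* The distance to [x s] is 1-Lipschitz in the state and grows at a rate at most [M], so the scalar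
   criterion yields the vector bound. *)
have := @absolutely_continuous_decrease R n x (fun u => `|x u - x s|) s t 1 M st.
rewrite subrr normr0 subr0; apply.
- exact: absolutely_continuousS (xac t (le_trans s0 st) tT).
- move=> u v su uv vt; rewrite mul1r (le_trans (ler_dist_dist _ _))//.
  by rewrite opprB addrA subrK.
apply: (@filterS _ _ (ae_filter_ringOfSetsType _)) xF => u xu su ut e e0.
have uT : (u%:E < T)%E by apply: le_lt_trans tT; rewrite lee_fin.
have u0 : 0 < u by exact: le_lt_trans su.
have [dx Fx] := xu u0 uT.
have [d d0 dP] := derivable_straddle dx e0.
exists d => // p q sp pu uq qt pqd.
have h1 := dP p q pu uq pqd.
have h2 := ler_distD (x p) (x q) (x s).
have pq : 0 <= q - p by rewrite subr_ge0 (le_trans pu).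
have h3 : `|(q - p) *: derive1 x u| <= M * (q - p).
  by rewrite normrZ ger0_norm// mulrC ler_wpM2r//; apply: FM Fx; exact: Xx (ltW u0) uT.
have h4 := ler_normD (x q - x p - (q - p) *: derive1 x u) ((q - p) *: derive1 x u).
rewrite subrK in h4.
by rewrite mulrDl; lra.
Qed.

(** Compactness provides a cluster point at [t1], and the Lipschitz estimate turns it into a limit
    with an explicit rate. *)
Lemma solution_limit (t1 : R) x : closed X -> bounded_set X ->
  solution X F t1%:E x -> exists2 z, X z &
    forall t : R, 0 <= t -> t < t1 -> `|z - x t| <= M * (t1 - t).
Proof.
move=> X_closed X_bounded xsol; have [t10 Xx _ _] := xsol.
rewrite lte_fin in t10.
have [|z [Xz zcl]] := cV_bounded_closed_compact X_bounded X_closed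
    (fmap_proper_filter x (at_left_proper_filter t1)).
  suff : (t1^'-) (x @^-1` X) by [].
  near=> s; apply: Xx; last by rewrite lte_fin; near: s; exact: nbhs_left_lt.
  by near: s; exact: nbhs_left_ge.
exists z => // t t0 tt1; apply/ler_addgt0Pr => e e0.
have A : fmap x t1^'- [set x s | s in [set s | t < s < t1]].
  suff : (t1^'-) (x @^-1` [set x s | s in [set s | t < s < t1]]) by [].
  near=> s; exists s => //; apply/andP; split; near: s.
    exact: nbhs_left_gt.
  exact: nbhs_left_lt.
have B : nbhs z (ball z e) by exact: nbhsx_ballx.
have [_ [[s /= /andP[ts st1] <-]]] := zcl _ _ A B.
rewrite -ball_normE /= => zs.
have := ler_distD (x s) z (x t).
have := solution_lipschitz xsol t0 (ltW ts); rewrite lte_fin => /(_ st1).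
have : M * (s - t) <= M * (t1 - t) by rewrite ler_wpM2l// lerD2r ltW.
lra.
Unshelve. all: by end_near. Qed.

Context (F_usc : upper_semicontinuous X F).
Context (F_nonempty : forall x, X x -> F x !=set0).
Context (F_compact : forall x, X x -> compact (F x)).
Context (F_convex : forall x, X x -> convex_set (F x)).

(** A new solution started at [z] is glued on at time [t1]. The two pieces fit because [z] is the
    limit of [x], and the junction, where a corner may arise, is a single time. *)
Lemma solution_extend (t1 : R) x z : solution X F t1%:E x -> X° z ->
  (forall t : R, 0 <= t -> t < t1 -> `|z - x t| <= M * (t1 - t)) ->
  ~ maximal_solution X F t1%:E x.
Proof.
move=> xsol Xz zx [_ xmax]; have [t10 Xx xac xF] := xsol; rewrite lte_fin in t10.
have [h [y h0 [y0 yM yX yF]]] :=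
  inclusion_exists F_usc F_nonempty F_compact F_convex FM Xz.
pose w t := if t < t1 then x t else y (t - t1).
have wx t : t < t1 -> w t = x t by rewrite /w => ->.
have wy t : t1 <= t -> w t = y (t - t1) by rewrite /w ltNge => ->.
have wM s t : 0 <= s -> s <= t -> `|w t - w s| <= M * (t - s).
  move=> s0 st; have [tt1|t1t] := ltP t t1.
    rewrite !wx ?(le_lt_trans st)//; apply: (solution_lipschitz xsol) => //.
  rewrite (wy t)//; have [st1|t1s] := ltP s t1.
    rewrite wx//.
    have := ler_distD z (y (t - t1)) (x s).
    have := zx s s0 st1; have := yM 0 (t - t1).
    rewrite y0 subr0 ger0_norm ?subr_ge0//; lra.
  rewrite wy// (le_trans (yM _ _))// ler_wpM2l//.
  by rewrite opprB addrA subrK ger0_norm// subr_ge0.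
have : (t1 + h)%:E = t1%:E.
  apply: (xmax _ w); last 1 first.
  - by move=> t t0; rewrite lte_fin => /wx.
  - split.
    + by rewrite lte_fin addr_gt0.
    + move=> t t0; rewrite lte_fin => th; have [tt1|t1t] := ltP t t1.
        by rewrite wx//; apply: Xx => //; rewrite lte_fin.
      by rewrite wy//; apply: yX; rewrite ?subr_ge0// ltrBlDl.
    + move=> b b0 _; apply: (lipschitz_absolutely_continuous M0) => s t s0 st _.
      exact: wM.
    + have yshift : forall s t, `|y (t - t1) - y (s - t1)| <= M * `|t - s|.
        by move=> s t; have := yM (s - t1) (t - t1); rewrite opprB addrA subrK.
      have t1ae : {ae @lebesgue_measure R, forall t, t != t1}.
        exists [set t1]; split; [exact: measurable_set1|exact: lebesgue_measure_set1|].
        by move=> t /= /negP; rewrite negbK => /eqP.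
      have := lipschitz_derivable_vector_ae yshift.
      apply: (@filterS3 _ _ (ae_filter_ringOfSetsType _)) xF t1ae => t xt tt1 dyt t0.
      rewrite lte_fin => th.
      move: tt1; rewrite neq_lt => /orP[tt1|t1t].
        have := xt t0; rewrite lte_fin => /(_ tt1)[dx Fx].
        have wxn : \forall s \near t, x s = w s.
          by near=> s; rewrite wx//; near: s; exact: lt_nbhsl.
        by have [dw ->] := near_eq_derive1 wxn dx; rewrite wx.
      have wyn : \forall s \near t, y (s - t1) = w s.
        by near=> s; rewrite wy//; apply: ltW; near: s; exact: lt_nbhsr.
      have [dw ->] := near_eq_derive1 wyn dyt.
      have [dy <-] := derivable_shift dyt.
      by rewrite wy ?ltW//; split => //; apply: yF; rewrite ?subr_gt0// ltrBlDl.
  - by rewrite lee_fin lerDl ltW.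
by move=> [] /eqP; rewrite -subr_eq0 addrAC subrr add0r gt_eqF.
Unshelve. all: by end_near. Qed.

End extension.

(** * The origin is an equilibrium *)

(** From [1 - t <= expR (- t)] one gets [expR t <= (1 - t)^-1], and [(1 - t) * (1 + t + 2 * t ^+ 2)
    = 1 + t ^+ 2 * (1 - 2 * t)]. *)
Lemma expR_sub1_le (R : realType) (t : R) : `|t| <= 1 / 2 ->
  expR t - 1 <= t + 2 * t ^+ 2.
Proof.
move=> /ler_normlP[h1 h2].
have t1 : 0 < 1 - t by lra.
have h : expR t <= (1 - t)^-1.
  rewrite -(opprK t) expRN lef_pV2 ?posrE ?expR_gt0//.
    by have := expR_ge1Dx (- t); rewrite opprK.
  by rewrite opprK.
rewrite lerBlDr; apply: le_trans h _.
rewrite -[X in X <= _]mul1r ler_pdivrMr//; nra.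
Qed.

(* Along -g the exponential starts with slope of order B, which beats the
   Lipschitz constant of V at 0 once B is large. *)
Lemma exponential_tilt (R : realType) n (V : 'cV[R]_n -> R) (g : 'cV[R]_n)
    (L r a : R) : 0 < r -> 0 < a -> 0 < dot g g -> V 0 = 0 ->
  (forall z w, `|z - 0| < r -> `|w - 0| < r -> `|V z - V w| <= L * `|z - w|) ->
  exists B, exists2 y, 0 < B & `|y| < r /\ V y + a * expR (B * dot g y) < a.
Proof.
move=> r0 a0; set G := dot g g => G0 V0 VL.
have g0 : 0 < `|g|.
  rewrite normr_gt0; apply: contraTneq G0 => g0.
  by rewrite /G g0 dot0r ltxx.
(* The step [s] along [- g] will be [(B * G)^-1], which makes the exponent exactly -1. The first
   term of [B] keeps the value of [V] there below [a / 2], and the second keeps the step inside the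
   ball. *)
pose B := (2 * `|L| * `|g| + 1) / (a * G) + 2 * `|g| / (G * r).
have B1 : 0 < (2 * `|L| * `|g| + 1) / (a * G).
  by rewrite divr_gt0 ?mulr_gt0// ltr_wpDl// !mulr_ge0.
have B2 : 0 < 2 * `|g| / (G * r) by rewrite divr_gt0 ?mulr_gt0.
have B0 : 0 < B by rewrite addr_gt0.
have BG0 : 0 < B * G by rewrite mulr_gt0.
pose s := (B * G)^-1.
have s0 : 0 < s by rewrite invr_gt0.
have sBG : B * G * s = 1 by rewrite mulfV// gt_eqF.
have ng : `|- s *: g| = s * `|g| by rewrite normrZ normrN gtr0_norm.
have sg : s * `|g| < r.
  rewrite mulrC ltr_pdivrMr// mulrC.
  have : 2 * `|g| / (G * r) * (G * r) <= B * (G * r).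
    by rewrite ler_pM2r ?mulr_gt0// lerDr ltW.
  rewrite mulfVK ?gt_eqF ?mulr_gt0// mulrA.
  by move: g0; lra.
exists B, (- s *: g) => //; rewrite ng; split => //.
rewrite dotZr -/G (_ : B * (- s * G) = -1); last by rewrite -sBG; ring.
have e1 : expR (-1 : R) <= 2^-1.
  rewrite expRN lef_pV2 ?posrE ?expR_gt0//.
  by have := expR_ge1Dx (1 : R); lra.
have V1 : V (- s *: g) <= `|L| * (s * `|g|).
  have := VL (- s *: g) 0; rewrite !subr0 ng normr0 V0 subr0 => /(_ sg r0) h.
  rewrite (le_trans (ler_norm _))// (le_trans h)// ler_wpM2r ?ler_norm//.
  by rewrite mulr_ge0// ltW.
have h3 : `|L| * (s * `|g|) < a / 2.
  rewrite -(ltr_pM2l BG0).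
  have -> : B * G * (`|L| * (s * `|g|)) = (B * G * s) * (`|L| * `|g|) by ring.
  rewrite sBG mul1r.
  have : (2 * `|L| * `|g| + 1) / (a * G) * (a * G) <= B * (a * G).
    by rewrite ler_pM2r ?mulr_gt0// lerDl ltW.
  rewrite mulfVK ?gt_eqF ?mulr_gt0//; lra.
have : a * expR (-1) <= a * 2^-1 by rewrite ler_pM2l.
lra.
Qed.

Section equilibrium.
Context {R : realType} {n : nat} (X : set 'cV[R]_n).
Context (F : 'cV[R]_n -> set 'cV[R]_n) (V : 'cV[R]_n -> R).
Context (X_closed : closed X) (X_bounded : bounded_set X).
Context (F_usc : upper_semicontinuous X F).
Context (F_nonempty : forall x, X x -> F x !=set0).
Context (F_compact : forall x, X x -> compact (F x)).
Context (F_convex : forall x, X x -> convex_set (F x)).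
Context (V_continuous : {within X, continuous V}).
Context (V_lipschitz : locally_lipschitz X° V).
Context (V_pos : forall x, X x -> x != 0 -> 0 < V x) (V_0 : V 0 = 0).
Context (X0 : X° 0).
Context (V_decr : forall x, X° x -> x != 0 ->
  forall q, time_derivative F V x q -> q <= 0).

Lemma equilibrium0 : F 0 0.
Proof.
apply: contrapT => nF; have X00 : X 0 by exact: interior_subset.
have [g [c c0 gc]] := compact_convex_separation (F_nonempty X00)
  (F_compact X00) (F_convex X00) nF.
have oO : open [set w | dot g w < 0].
  exact: (open_comp (fun w _ => @dot_continuous _ _ g w) (@open_lt _ 0)).
have FO : F 0 `<=` [set w | dot g w < 0].
  by move=> w /gc /=; rewrite dot0r; lra.
have [v0 Fv0] := F_nonempty X00.
have G0 : 0 < dot g g.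
  apply: dotvv_gt0; apply: contraTneq (FO _ Fv0) => -> /=.
  by rewrite dotC dot0r ltxx.
have /nbhs_ballP[r1 /= r10 r1F] := F_usc X00 oO FO.
have /nbhs_ballP[r2 /= r20 r2X] : nbhs (0 : 'cV[R]_n) X° by exact: nbhs_interior.
have [L [r3 r30 VL]] := locally_lipschitz_ball V_lipschitz X0.
pose r4 := Num.min r1 r2.
have r40 : 0 < r4 by rewrite lt_min r10.
pose r := Num.min (r4 / 2) r3.
have r0 : 0 < r by rewrite lt_min r30 divr_gt0.
have rr4 : r < r4.
  rewrite (le_lt_trans (y := r4 / 2)) ?ge_min ?lexx//.
  by rewrite ltr_pdivrMr// ltr_pMr// ltr1n.
have inr y : `|y| <= r -> X° y /\ F y `<=` [set w | dot g w < 0].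
  move=> yr; have yr4 := le_lt_trans yr rr4.
  have [y1 y2] : `|y| < r1 /\ `|y| < r2 by apply/andP; rewrite -lt_min.
  have Xy : X° y by apply: r2X; rewrite -ball_normE /= sub0r normrN.
  split => //; apply: (r1F y); last exact: interior_subset.
  by rewrite -ball_normE /= sub0r normrN.
have [m m0 mP] := sublevel_norm X_closed X_bounded V_continuous V_pos r0.
(* [a] is the value of the tilted function at 0, so its minimum is lower and lies elsewhere. There
   [V] is below [a], hence below [m], which puts the minimum strictly inside the ball. *)
pose a := m / 2; have a0 : 0 < a by rewrite divr_gt0.
have [|B [y1 B0 [y1r y1a]]] := exponential_tilt (L := L) r0 a0 G0 V_0.
  by move=> z w; rewrite !lt_min => /andP[_ zr] /andP[_ wr]; exact: VL.
pose K : set 'cV[R]_n := closed_ball_ Num.norm 0 r.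
have KE y : K y <-> `|y| <= r by rewrite /K /closed_ball_ /= sub0r normrN.
have cK : compact K.
  apply: cV_bounded_closed_compact; last exact: closed_closed_ball_.
  exists r; split; first exact: num_real.
  by move=> M rM y /KE yr; exact: le_trans (ltW rM).
have KX : K `<=` X by move=> y /KE /inr[/interior_subset].
pose W y := V y + a * expR (B * dot g y).
have cW : {within K, continuous W}.
  apply: continuous_add; first exact: continuous_subspaceW V_continuous.
  apply: continuous_subspaceT; apply: continuous_mul; first exact: cst_continuous.
  move=> y; apply: (@continuous_comp _ _ _ (fun y => B * dot g y) expR).
    by apply: continuous_mul; [exact: cst_continuous|exact: dot_continuous].
  exact: continuous_expR.
have Ky1 : K y1 by apply/KE; exact: ltW.
have [y /set_mem Ky ymin] := compact_EVT_min (ex_intro _ y1 Ky1) cK cW.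
have Wya : W y < a by apply: le_lt_trans (ymin y1 (mem_set Ky1)) y1a.
have y0 : y != 0.
  by apply: contraTneq Wya => ->; rewrite /W V_0 dot0r mulr0 expR0 mulr1 add0r ltxx.
have /KE yr := Ky; have [Xy Fyg] := inr y yr.
have {}yr : `|y| < r.
  apply: mP; first exact: KX.
  have := mulr_ge0 (ltW a0) (expR_ge0 (B * dot g y)).
  by move: Wya; rewrite /W /a; move: m0; lra.
pose E := expR (B * dot g y).
have E0 : 0 < E by exact: expR_gt0.
(* Minus the gradient of the tilt at [y]: at a minimum, [V] grows at least as fast as the tilt
   falls. On [F y] the product with [g] is negative, so that with [p] is positive. *)
pose p := - (a * B * E) *: g.
have gp : clarke_gradient V y p.
  move=> w; apply/lee_addgt0Pr => e e0.
  rewrite -leeBlDr// -EFinB.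
  apply: clarke_derivative_ge => d d0.
  pose b := B * dot g w.
  (* Each term after 1 bounds [s = D^-1] for one purpose: staying in the ball, using the quadratic
     bound on the exponential, making its second order term at most [e], and [s < d]. *)
  pose D := 1 + `|w| / (r - `|y|) + 2 * `|b| + 2 * a * E * b ^+ 2 / e + 2 / d.
  have ry : 0 < r - `|y| by rewrite subr_gt0.
  have [D1 D2 D3 D4] : [/\ 0 <= `|w| / (r - `|y|), 0 <= 2 * `|b|,
      0 <= 2 * a * E * b ^+ 2 / e & 0 < 2 / d].
    split; [exact: divr_ge0 (normr_ge0 _) (ltW ry)|exact: mulr_ge0| |exact: divr_gt0].
    apply: divr_ge0 (ltW e0); apply: mulr_ge0 (sqr_ge0 b).
    by rewrite mulr_ge0 ?(ltW E0)// mulr_ge0 ?(ltW a0).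
  have D0 : 0 < D by rewrite /D; lra.
  pose s := D^-1.
  have s0 : 0 < s by rewrite invr_gt0.
  have sle z : z <= D -> s * z <= 1.
    by move=> zD; rewrite mulrC ler_pdivrMr// mul1r.
  exists y, s; split.
  - by rewrite subrr normr0.
  - rewrite s0 -(ltr_pM2r (x := 2 / d))//.
    rewrite mulrA (mulrC d) mulfVK ?gt_eqF//.
    have : s * (2 / d) <= 1 by apply: sle; rewrite /D; lra.
    lra.
  have ysw : `|y + s *: w| <= r.
    have : s * (`|w| / (r - `|y|)) <= 1 by apply: sle; rewrite /D; lra.
    rewrite mulrA ler_pdivrMr// mul1r => h.
    by rewrite (le_trans (ler_normD _ _))// normrZ (gtr0_norm s0); lra.
  have := ymin _ (mem_set ((KE _).2 ysw)).
  rewrite /W dotDr dotZr mulrDr expRD -/E (_ : B * (s * dot g w) = s * b); last first.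
    by rewrite /b; ring.
  have sb : `|s * b| <= 1 / 2.
    have : s * (2 * `|b|) <= 1 by apply: sle; rewrite /D; lra.
    by rewrite (normrM s b) (gtr0_norm s0); lra.
  have h1 := expR_sub1_le sb.
  have h2 : s * (2 * a * E * b ^+ 2 / e) <= 1 by apply: sle; rewrite /D; lra.
  rewrite mulrA ler_pdivrMr// mul1r in h2.
  have aE : 0 < a * E by rewrite mulr_gt0.
  have h3 : a * E * (expR (s * b) - 1) <= a * E * (s * b + 2 * (s * b) ^+ 2).
    by rewrite ler_pM2l.
  have h4 : s * (s * (2 * a * E * b ^+ 2)) <= s * e by rewrite ler_pM2l.
  rewrite -/(dot p w) /p dotZl.
  have -> : - (a * B * E) * dot g w = - (a * E * b) by rewrite /b; ring.
  rewrite exprMn in h3.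
  nra.
have [v Fv] := F_nonempty (KX _ Ky).
have := V_decr Xy y0 (ex_intro2 _ _ p gp (ex_intro2 _ _ v Fv erefl)).
rewrite -/(dot p v) /p dotZl leNgt => /negP; apply.
rewrite mulNr -mulrN mulr_gt0//; first by rewrite !mulr_gt0.
by rewrite oppr_gt0; exact: Fyg.
Qed.

End equilibrium.

Theorem theorem1 (R : realType) (n m r : nat)
    (A : 'I_r -> 'M[R]_n) (B : 'I_r -> 'M[R]_(n, m)) (ulo uhi : 'cV[R]_m)
    (X Xg : set 'cV[R]_n) (u : 'cV[R]_n -> 'cV[R]_m)
    (F : 'cV[R]_n -> set 'cV[R]_n) (V : 'cV[R]_n -> R)
    (X_closed : closed X) (X_bounded : bounded_set X) (X0 : X 0)
    (Xg_sub : Xg `<=` X) (Xg0 : Xg 0)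
    (u_box : forall x, X x -> box ulo uhi (u x))
    (F_usc : upper_semicontinuous X F)
    (F_nonempty : forall x, X x -> F x !=set0)
    (F_compact : forall x, X x -> compact (F x))
    (F_convex : forall x, X x -> convex_set (F x))
    (F_closed_loop : forall x, X x ->
       forall a, simplex a -> F x (closed_loop A B u a x))
    (V_continuous : {within X, continuous V})
    (V_lipschitz : locally_lipschitz X° V)
    (V_pos : forall x, X x -> x != 0 -> 0 < V x)
    (V_0 : V 0 = 0)
    (V_boundary : forall x, boundary X x -> 1 <= V x)
    (V_decr : forall x, X° x -> ~ Xg x ->
       forall q, time_derivative F V x q -> q + (1 - V x) ^+ 2 <= 0)
    (V_decr_g : forall x, X° x -> Xg x -> x != 0 ->
       forall q, time_derivative F V x q -> q < 0) :
  [/\ asymptotically_stable X F,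
      (forall T x, solution X F T x -> strict_sublevel X V (x 0) ->
         forall t : R, 0 <= t -> (t%:E < T)%E -> strict_sublevel X V (x t)) /\
      (forall T x, maximal_solution X F T x -> strict_sublevel X V (x 0) ->
         T = +oo%E /\ x t @[t --> +oo] --> (0 : 'cV[R]_n)) &
      forall T x, maximal_solution X F T x -> strict_sublevel X V (x 0) ->
         exists t : R, [/\ 0 <= t, (t%:E < T)%E,
           t <= V (x 0) / (1 - V (x 0)) & Xg (x t)]].
Proof.
have Xo0 : X° 0 by apply: (sublevel_interior V_boundary X0); rewrite V_0.
have [M M0 FM] := usc_bounded F_usc F_compact X_closed X_bounded.
have VX T x : solution X F T x -> X (x 0) by case=> T0 Xx _ _; exact: Xx.
(* At a finite end the limit of the solution still has [V] at most [V (x 0)], so it is interior to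
   [X] and the solution could be continued. *)
have time_infinite T x : maximal_solution X F T x -> V (x 0) < 1 -> T = +oo%E.
  move=> xmax V1; have [xsol _] := xmax; have [T0 Xx _ _] := xsol.
  case: T => [t1| |] // in xmax xsol T0 Xx *.
  exfalso; have t10 : 0 < t1 by rewrite -lte_fin.
  have [z Xz zx] := solution_limit M0 FM X_closed X_bounded xsol.
  apply: (solution_extend M0 FM F_usc F_nonempty F_compact F_convex xsol _ zx xmax).
  apply: (sublevel_interior V_boundary Xz); apply: (le_lt_trans _ V1).
  apply/ler_addgt0Pr => e e0.
  have [d d0 dP] := within_continuous_dist V_continuous Xz e0.
  have [f f0 Mf] := near_zero_multiple d0 M0.
  pose t := Num.max 0 (t1 - f).
  have t0 : 0 <= t by rewrite le_max lexx.
  have tt1 : t < t1 by rewrite gt_max t10 ltrBlDr ltrDl.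
  have tT : (t%:E < t1%:E)%E by rewrite lte_fin.
  have tf : t1 - t <= f by rewrite lerBlDr addrC -lerBlDr le_max lexx orbT.
  have : `|V (x t) - V z| < e.
    apply: dP; first exact: Xx.
    rewrite distrC; apply: le_lt_trans (zx t t0 tt1) _; apply: le_lt_trans Mf.
    by rewrite ler_wpM2l.
  have : V (x t) <= V (x 0).
    by apply: (trajectory_nonincreasing F_compact V_continuous V_lipschitz V_pos V_0
      V_boundary V_decr V_decr_g xsol).
  by rewrite ltr_norml => ? /andP[? ?]; lra.
have attractive T x : maximal_solution X F T x -> V (x 0) < 1 ->
    T = +oo%E /\ x t @[t --> +oo] --> (0 : 'cV[R]_n).
  move=> xmax V1; have TE := time_infinite _ _ xmax V1; split => //.
  move: xmax; rewrite TE => -[xsol _].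
  by apply: (trajectory_cvg0 X_closed X_bounded F_usc F_compact V_continuous
    V_lipschitz V_pos V_0 V_boundary V_decr V_decr_g xsol).
have small (l : R) : 0 < l -> exists2 d : R, 0 < d &
    forall y, X y -> `|y| < d -> V y < l.
  move=> l0; have [d d0 dP] := within_continuous_dist V_continuous X0 l0.
  exists d => // y Xy yd; have := dP y Xy; rewrite subr0 V_0 subr0 => /(_ yd).
  exact: le_lt_trans (ler_norm _).
split.
- split.
  + apply: (equilibrium0 X_closed X_bounded F_usc F_nonempty F_compact F_convex
      V_continuous V_lipschitz V_pos V_0 Xo0) => y Xy y0 q qy.
    have [Xgy|Xgy] := pselect (Xg y); first exact: ltW (V_decr_g _ Xy Xgy y0 _ qy).
    by have := V_decr _ Xy Xgy _ qy; have := sqr_ge0 (1 - V y); lra.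
  + move=> e e0; have [l l0 lP] := sublevel_norm X_closed X_bounded V_continuous
      V_pos e0.
    (* The bound 1 makes [V] nonincreasing along the solution; the bound [l] then controls the norm
       at all later times. *)
    have [d d0 dP] := small (Num.min l 1) ltac:(by rewrite lt_min l0 ltr01).
    exists d => // T x xsol x0d t t0 tT.
    have := dP _ (VX _ _ xsol) x0d; rewrite lt_min => /andP[Vl V1].
    apply: lP; first by have [_ Xx _ _] := xsol; exact: Xx.
    apply: le_lt_trans Vl.
    by apply: (trajectory_nonincreasing F_compact V_continuous V_lipschitz V_pos V_0
      V_boundary V_decr V_decr_g xsol).
  + have [d d0 dP] := small 1 ltr01; exists d => // T x xmax x0d.
    by apply: attractive => //; apply: dP => //; apply: VX xmax.1.
- split=> [T x xsol [X0x V1] t t0 tT|T x xmax [_ V1]]; last exact: attractive.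
  split; first by have [_ Xx _ _] := xsol; exact: Xx.
  by apply: (trajectory_sublevel F_compact V_continuous V_lipschitz V_pos V_0
    V_boundary V_decr V_decr_g xsol).
- move=> T x xmax [_ V1]; have TE := time_infinite _ _ xmax V1.
  have tT (t : R) : (t%:E < T)%E by rewrite TE ltry.
  have [t [t0 tle Xgt]] := trajectory_reaches Xg0 F_compact V_continuous
    V_lipschitz V_pos V_0 V_boundary V_decr V_decr_g xmax.1 V1 (tT _).
  by exists t; split.
Qed.
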